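(* Let $G$ be a finite soluble group, let $a$ and $b$ be non-negative integers, let $s\in\{a,b\}$ and $t=a+b-s$. Assume that either $t\neq 1$ or $G$ has the following property: if $A$ is a non-trivial irreducible $G$-module that is $G$-isomorphic to a complemented chief factor of $G$, then $|\operatorname{End}_G(A)|>2$ (this property holds in particular when the derived subgroup of $G$ is either nilpotent or of odd order). Then, in the graph $\Gamma^*_{a,b}(G)$, given any two vertices $x_1,x_2\in V_s$, there exists $y\in V_t$ which is adjacent to both $x_1$ and $x_2$.
   Context: For a finite group $G$ and non-negative integers $a,b$ (the order of the two indices is immaterial: $\Gamma_{a,b}(G)=\Gamma_{b,a}(G)$), $\Gamma_{a,b}(G)$ is the undirected graph, possibly with loops, whose vertices are the elements of $G^a\cup G^b$ (a disjoint union if $a\neq b$, just $G^a$ if $a=b$; $G^0$ consists of the single empty tuple), in which $(x_1,\dots,x_a)\in G^a$ and $(y_1,\dots,y_b)\in G^b$ are adjacent if and only if $\langle x_1,\dots,x_a,y_1,\dots,y_b\rangle=G$. If $a\neq b$ there are no other edges; if $a=b$ there is a loop at $x\in G^a$ exactly when the entries of $x$ generate $G$. A vertex is isolated if it is adjacent to no vertex (itself included). $\Gamma^*_{a,b}(G)$ is obtained from $\Gamma_{a,b}(G)$ by deleting the isolated vertices. $V_a$ and $V_b$ denote the sets of vertices of $\Gamma^*_{a,b}(G)$ belonging to $G^a$ and $G^b$ respectively (if $a=b$, $V_a=V_b$ is the whole vertex set). A chief factor $X/Y$ of $G$ is complemented if $X/Y$ has a complement in $G/Y$; abelian chief factors are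 regarded as $G$-modules via conjugation. A non-trivial irreducible $G$-module is one on which $G$ acts non-trivially. *)

(* Defs.v *)
From HB Require Import structures.
From mathcomp Require Import all_boot all_fingroup all_solvable.
Set Implicit Arguments.
Unset Strict Implicit.
Unset Printing Implicit Defensive.
Local Open Scope group_scope.

(** ** The graphs Gamma_{a,b}(G) and Gamma*_{a,b}(G)

A tuple of group elements is a sequence, so that G ^ k consists of the
sequences of length k with entries in G. With this encoding the union of G ^ a
and G ^ b is automatically disjoint when a != b and equal to G ^ a when
a = b. *)

Definition in_pow (gT : finGroupType) (G : {group gT}) (k : nat) (x : seq gT)
  : bool := (size x == k) && all [in G] x.

Definition Gamma_vertex (gT : finGroupType) (G : {group gT}) (a b : nat)
  (x : seq gT) : bool := in_pow G a x || in_pow G b x.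

Definition Gamma_adj (gT : finGroupType) (G : {group gT}) (a b : nat)
  (x y : seq gT) : bool :=
  ((in_pow G a x && in_pow G b y) || (in_pow G b x && in_pow G a y))
  && (<<[set:: x ++ y]>> == G :> {set gT}).

(* The quantifier includes y = x, so a vertex carrying a loop is not isolated. *)
Definition Gamma_isolated (gT : finGroupType) (G : {group gT}) (a b : nat)
  (x : seq gT) : Prop :=
  forall y : seq gT, Gamma_vertex G a b y -> ~~ Gamma_adj G a b x y.

Definition Gamma_star_vertex (gT : finGroupType) (G : {group gT}) (a b : nat)
  (x : seq gT) : Prop :=
  Gamma_vertex G a b x /\ ~ Gamma_isolated G a b x.

Definition Gamma_star_adj (gT : finGroupType) (G : {group gT}) (a b : nat)
  (x y : seq gT) : Prop :=
  [/\ Gamma_star_vertex G a b x, Gamma_star_vertex G a b y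
    & Gamma_adj G a b x y].

(* The set V_s, for s equal to a or b. *)
Definition Gamma_star_part (gT : finGroupType) (G : {group gT}) (a b s : nat)
  (x : seq gT) : Prop :=
  Gamma_star_vertex G a b x /\ in_pow G s x.

(** ** Irreducible modules and complemented chief factors

A finite G-module is a finite abelian group A, written multiplicatively, with
an action of G by automorphisms: [to : groupAction G [set: A]]. *)

Definition nontrivial_irr_module (gT : finGroupType) (G : {group gT})
  (A : finGroupType) (to : groupAction G [set: A]) : Prop :=
  [/\ abelian [set: A], acts_irreducibly G [set: A] to
    & ~~ (G \subset 'C([set: A] | to))].

(* End_G(A), the zero endomorphism included. *)
Definition End_module (gT : finGroupType) (G : {group gT})
  (A : finGroupType) (to : groupAction G [set: A]) : {set {ffun A -> A}} :=
  [set f : {ffun A -> A} |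
    [forall x, forall y, f (x * y) == f x * f y] &&
    [forall x, forall g in G, f (to x g) == to (f x) g]].

(* Note the argument order of the library: [chief_factor G Y X] is about X / Y. *)
Definition complemented_chief_factor (gT : finGroupType)
  (G X Y : {group gT}) : Prop :=
  chief_factor G Y X /\ [splits G / Y, over X / Y].

(* A is G-isomorphic to X / Y, on which g in G acts as conjugation by gY. *)
Definition module_isog_factor (gT : finGroupType) (G X Y : {group gT})
  (A : finGroupType) (to : groupAction G [set: A]) : Prop :=
  exists2 f : {morphism [set: A] >-> coset_of Y},
    isom [set: A] (X / Y) f
    & forall (x : A) (g : gT), g \in G -> f (to x g) = f x ^ coset Y g.

Definition End_gt2_property (gT : finGroupType) (G : {group gT}) : Prop :=
  forall (A : finGroupType) (to : groupAction G [set: A]),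
    nontrivial_irr_module to ->
    (exists X Y : {group gT},
        complemented_chief_factor G X Y /\ module_isog_factor X Y to) ->
    2 < #|End_module to|.

(* Main.v *)
Require Import Defs.
From HB Require Import structures.
From mathcomp Require Import all_boot ssralg all_fingroup all_solvable zify.
Import GRing.Theory.
Set Implicit Arguments.
Unset Strict Implicit.
Unset Printing Implicit Defensive.
Local Open Scope group_scope.

(** Fix the soluble group G and write H1, H2 for the subgroups generated by the
entries of x1 and x2; a common neighbour is a t-tuple y with <H1, y> = G and
<H2, y> = G. Call y good modulo a normal subgroup M if both equalities hold
modulo M. Every tuple is good modulo G, and [common_completion] descends to
M = 1 by lifting a good tuple from one quotient of G to a larger one, so that
everything happens in one step ([common_step]): y is good modulo each nontrivial
normal subgroup N, and has to be corrected by elements of N.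

If the Frattini subgroup is nontrivial, N is taken inside it and nothing has to
be done. Otherwise let N be an abelian minimal normal subgroup. For n in N^t the
group <Hj, y n> supplements N, hence is G or a complement of N. A complement of
N is the kernel of a derivation d : G -> N that is the identity on N, and it
contains Hj and y n exactly when d vanishes on Hj and n_i = d(y_i)^-1. So the
bad corrections for Hj are indexed by such derivations ([lift_or_bad]). Let K_j
be the group of derivations G -> N that vanish on Hj. As Hj is completed to a
generating set by some t-tuple, evaluation on that tuple embeds K_j in N^t
([card_der_le]). Composing with the endomorphisms of the G-module N turns each
derivation that is the identity on N into |End_G(N)| many with distinct
restrictions to N, so at most |K_j| / |End_G(N)| corrections are bad for Hj
([card_bad_endos]). When |End_G(N)| > 2 the two bad sets cannot cover N^t.

There remains the case in which every minimal normal subgroup has exactly two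
endomorphisms. All of them are then elementary abelian 2-groups, and so is the
socle S. If S = G, two subgroups of index at most 2^t have a common completion,
because two proper subgroups never cover G ([index_exp2_common]). Otherwise take
a minimal normal subgroup E/S of G/S; as S is its own centraliser, E acts
nontrivially on some minimal normal N, which forces |E/S| to be odd. For t = 0
there is nothing to choose, and for t = 1 the hypothesis on chief factors
excludes such an N. For t >= 2, the derivations that vanish on S number at most
|N| ([card_der_coprime_le]), fewer than half of N^t. If the two bad sets cover
N^t, each is exactly one half of it; then half of N^t is also a lower bound for
the number of derivations that vanish on H1 and N, and one of these, k, is
nontrivial on a second minimal normal subgroup P. It identifies P with N, and
every derivation restricts to P as 1 or k. Correcting y by a suitable element of
P^t, read off from k and from one derivation in each half, keeps it good modulo
N and makes the two bad sets intersect, so they no longer cover N^t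
([lift_both_two]).

The second assertion is about a noncentral chief factor N. If the derived
subgroup centralises N, which nilpotency implies, conjugation by an element of G
is an endomorphism of N; were 0 and 1 the only endomorphisms, N would be
central. If |End_G(N)| = 2 then N is a 2-group, whereas N = [N, G] lies in the
derived subgroup, which is impossible when that has odd order. *)

(** * Derivations *)

Section Derivations.

Variable gT : finGroupType.
Implicit Types (G H K L M N P S W : {group gT}) (A B : {set gT}).
Implicit Types (d k f : {ffun gT -> gT}) (g h : gT).

(** The derivations G -> N, for the action by conjugation, that vanish on A. The
value 1 off G makes such a function determined by its restriction to G, so that
the cardinal of this set counts derivations. *)
Definition derivations G N A : {set {ffun gT -> gT}} :=
  [set d : {ffun gT -> gT} |
    [&& [forall g in G, d g \in N],
        [forall g in G, forall h in G, d (g * h) == d g ^ h * d h],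
        [forall g, (g \notin G) ==> (d g == 1)]
      & [forall a in A, d a == 1]]].

(** The endomorphisms of N that commute with the action of G, with value 1 off N
for the same reason. *)
Definition equi_endos G N : {set {ffun gT -> gT}} :=
  [set f : {ffun gT -> gT} |
    [&& [forall x in N, f x \in N],
        [forall x in N, forall y in N, f (x * y) == f x * f y],
        [forall x in N, forall g in G, f (x ^ g) == f x ^ g]
      & [forall x, (x \notin N) ==> (f x == 1)]]].

Lemma derP G N A d :
  reflect [/\ {in G, forall g, d g \in N},
              {in G &, forall g h, d (g * h) = d g ^ h * d h},
              (forall g, g \notin G -> d g = 1) & {in A, forall a, d a = 1}]
          (d \in derivations G N A).
Proof.
rewrite inE; apply: (iffP and4P) => [] [d1 d2 d3 d4]; split.
- by move=> g Gg; apply: (forall_inP d1).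
- move=> g h Gg Gh.
  by have /forall_inP/(_ h Gh)/eqP := forall_inP d2 g Gg.
- by move=> g /(implyP (forallP d3 g))/eqP.
- by move=> a Aa; apply/eqP/(forall_inP d4).
- by apply/forall_inP.
- by apply/forall_inP=> g Gg; apply/forall_inP=> h Gh; rewrite d2.
- by apply/forallP=> g; apply/implyP=> /d3->.
- by apply/forall_inP=> a /d4->.
Qed.

Lemma equi_endosP G N f :
  reflect [/\ {in N, forall x, f x \in N}, {in N &, {morph f : x y / x * y}},
              {in N & G, forall x g, f (x ^ g) = f x ^ g}
            & forall x, x \notin N -> f x = 1]
          (f \in equi_endos G N).
Proof.
rewrite inE; apply: (iffP and4P) => [] [f1 f2 f3 f4]; split.
- by move=> g Gg; apply: (forall_inP f1).
- by move=> x y Nx Ny; have /forall_inP/(_ y Ny)/eqP := forall_inP f2 x Nx.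
- by move=> x g Nx Gg; have /forall_inP/(_ g Gg)/eqP := forall_inP f3 x Nx.
- by move=> g /(implyP (forallP f4 g))/eqP.
- by apply/forall_inP.
- by apply/forall_inP=> x Nx; apply/forall_inP=> y Ny; rewrite f2.
- by apply/forall_inP=> x Nx; apply/forall_inP=> g Gg; rewrite f3.
- by apply/forallP=> g; apply/implyP=> /f4->.
Qed.

Lemma der_in G N A d g : d \in derivations G N A -> g \in G -> d g \in N.
Proof. by case/derP=> d1 _ _ _ /d1. Qed.

Lemma derM G N A d g h : d \in derivations G N A -> g \in G -> h \in G ->
  d (g * h) = d g ^ h * d h.
Proof. by case/derP=> _ d2 _ _ Gg Gh; rewrite d2. Qed.

Lemma der_out G N A d g : d \in derivations G N A -> g \notin G -> d g = 1.
Proof. by case/derP=> _ _ d3 _ /d3. Qed.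

Lemma der_triv G N A d a : d \in derivations G N A -> a \in A -> d a = 1.
Proof. by case/derP=> _ _ _ d4 /d4. Qed.

Lemma der1 G N A d : d \in derivations G N A -> d 1 = 1.
Proof.
move=> Dd; have := derM Dd (group1 G) (group1 G).
by rewrite mulg1 conjg1 => e; apply: (mulgI (d 1)); rewrite mulg1 -e.
Qed.

Lemma derS G N A B d :
  B \subset A -> d \in derivations G N A -> d \in derivations G N B.
Proof.
move=> sBA /derP[d1 d2 d3 d4]; apply/derP; split=> // b Bb.
exact/d4/(subsetP sBA).
Qed.

Lemma derU G N A B d :
  (d \in derivations G N (A :|: B))
    = (d \in derivations G N A) && (d \in derivations G N B).
Proof.
apply/idP/andP => [Dd | [DA DB]].
  by split; apply: derS Dd; rewrite ?subsetUl ?subsetUr.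
case/derP: (DA) => d1 d2 d3 _; apply/derP; split=> // a /setUP[] Ha.
  exact: der_triv DA Ha.
exact: der_triv DB Ha.
Qed.

Lemma der_kerP G N A d : d \in derivations G N A ->
  group_set [set g in G | d g == 1].
Proof.
move=> Dd; apply/group_setP; split; first by rewrite inE group1 (der1 Dd) eqxx.
move=> g h; rewrite !inE => /andP[Gg /eqP dg] /andP[Gh /eqP dh].
by rewrite groupM // (derM Dd) // dg dh conj1g mulg1 eqxx.
Qed.

Lemma der_gen G N A d : d \in derivations G N A -> A \subset G ->
  d \in derivations G N <<A>>.
Proof.
move=> Dd sAG; case/derP: (Dd) => d1 d2 d3 d4; apply/derP; split=> // a Aa.
have /subsetP/(_ a Aa): <<A>> \subset Group (der_kerP Dd).
  rewrite gen_subG; apply/subsetP=> b Ab.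
  by rewrite inE (subsetP sAG) ?d4 ?eqxx.
by rewrite inE => /andP[_ /eqP].
Qed.

Section Abelian.

Variables (G N : {group gT}).
Hypotheses (nNG : N <| G) (abN : abelian N).

Let sNG : N \subset G := normal_sub nNG.
Let memJ x g : x \in N -> g \in G -> x ^ g \in N.
Proof. by move=> Nx Gg; rewrite memJ_norm // (subsetP (normal_norm nNG)). Qed.

Let cN x y : x \in N -> y \in N -> x * y = y * x.
Proof. by move=> Nx Ny; apply: (centsP abN). Qed.

Lemma der_mul A d k : d \in derivations G N A -> k \in derivations G N A ->
  d * k \in derivations G N A.
Proof.
move=> Dd Dk; apply/derP; split=> [g Gg|g h Gg Gh|g nGg|a Aa].
- by rewrite mulg_ffun groupM ?(der_in Dd, der_in Dk).
- rewrite !mulg_ffun (derM Dd) // (derM Dk) // conjMg.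
  rewrite -[LHS]mulgA -[RHS]mulgA; congr (_ * _).
  have Nk := memJ (der_in Dk Gg) Gh; have Nd := der_in Dd Gh.
  by rewrite [LHS]mulgA [RHS]mulgA (cN Nd Nk).
- by rewrite mulg_ffun (der_out Dd) // (der_out Dk) ?mulg1.
- by rewrite mulg_ffun (der_triv Dd) // (der_triv Dk) ?mulg1.
Qed.

Lemma der_inv A d : d \in derivations G N A -> d^-1 \in derivations G N A.
Proof.
move=> Dd; apply/derP; split=> [g Gg|g h Gg Gh|g nGg|a Aa]; rewrite !invg_ffun.
- by rewrite groupV (der_in Dd).
- have Ngh: d g ^ h \in N by rewrite memJ ?(der_in Dd).
  by rewrite (derM Dd) // invMg -conjVg cN ?groupV ?(der_in Dd) // conjVg
    groupV.
- by rewrite (der_out Dd) ?invg1.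
- by rewrite (der_triv Dd) ?invg1.
Qed.

Lemma der_comp A d f : d \in derivations G N A -> f \in equi_endos G N ->
  [ffun g => f (d g)] \in derivations G N A.
Proof.
move=> Dd /equi_endosP[f1 f2 f3 f4].
have f11: f 1 = 1.
  by apply: (mulgI (f 1)); rewrite mulg1 -f2 ?mulg1.
apply/derP; split=> [g Gg|g h Gg Gh|g nGg|a Aa]; rewrite !ffunE.
- exact/f1/(der_in Dd).
- by rewrite (derM Dd) // f2 ?f3 ?memJ ?(der_in Dd).
- by rewrite (der_out Dd).
- by rewrite (der_triv Dd).
Qed.

Lemma der_hom d P : d \in derivations G N 1 -> P \subset G ->
  P \subset 'C(N) -> {in P &, {morph d : x y / x * y}}.
Proof.
move=> Dd sPG cPN x y Px Py; rewrite /= (derM Dd) ?(subsetP sPG) //.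
congr (_ * _); apply/conjg_fixP/commgP/esym/(centsP cPN) => //.
exact/(der_in Dd)/(subsetP sPG).
Qed.

(** Compare d on the two sides of x g = g x^g. *)
Lemma der_equi d P : d \in derivations G N 1 -> P <| G -> P \subset 'C(N) ->
  {in P & G, forall x g, d (x ^ g) = d x ^ g}.
Proof.
move=> Dd /andP[sPG nPG] cPN x g Px Gg; have Gx := subsetP sPG x Px.
have Pxg: x ^ g \in P by rewrite memJ_norm // (subsetP nPG).
have: d (x * g) = d (g * x ^ g) by rewrite -conjgC.
rewrite (derM Dd) // (derM Dd) ?groupJ //.
have ->: d g ^ (x ^ g) = d g.
  by apply/conjg_fixP/commgP/esym/(centsP cPN) => //; apply: (der_in Dd).
have Nxg: d (x ^ g) \in N by rewrite (der_in Dd) ?groupJ.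
by rewrite [RHS](cN (der_in Dd Gg) Nxg) => /mulIg.
Qed.

(** Writing g = m n with m in M and n in N, the derivation sends g to n; the
cocycle identity is the product rule for this factorisation. *)
Lemma compl_der M : M \subset G -> M :&: N = 1 -> M * N = G ->
  exists2 d, d \in derivations G N M & {in N, forall x, d x = x}.
Proof.
move=> sMG tiMN defG.
pose d := [ffun g => if g \in G then remgr M N g else 1].
have decomp g : g \in G -> exists2 m, m \in M & exists2 n, n \in N & g = m * n.
  by rewrite -{1}defG => /mulsgP[m n Mm Nn ->]; exists m => //; exists n.
have dE m n : m \in M -> n \in N -> d (m * n) = n.
  by move=> Mm Nn; rewrite ffunE -{1}defG mem_mulg // remgrMid.
exists d => [|x Nx]; last by rewrite -[x in LHS]mul1g dE.
apply/derP; split=> [g|g h|g|a Ma].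
- by case/decomp=> m Mm [n Nn ->]; rewrite dE.
- case/decomp=> m Mm [n Nn ->] /decomp[p Mp [q Nq ->]].
  rewrite (dE m n) // (dE p q) //.
  have Nnp: n ^ p \in N by rewrite memJ // (subsetP sMG).
  have ->: m * n * (p * q) = m * p * (n ^ p * q).
    by rewrite -[LHS]mulgA -[RHS]mulgA [n * _]mulgA [n * p]conjgC -[_ * q]mulgA.
  rewrite (dE _ _ (groupM Mm Mp) (groupM Nnp Nq)) conjgM; congr (_ * _).
  by apply/esym/conjg_fixP/commgP; apply: cN.
- by move/negbTE=> nGg; rewrite ffunE nGg.
- by rewrite -[a]mulg1 dE.
Qed.

End Abelian.
End Derivations.

(** * Lifting generation through a minimal normal subgroup *)

Section Lifting.

Variable gT : finGroupType.
Implicit Types (G H K L M N P S W : {group gT}) (A B : {set gT}).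
Implicit Types (d k f : {ffun gT -> gT}) (g h : gT).

Definition cpow t A : {set {ffun 'I_t -> gT}} := [set y in ffun_on (mem A)].

Definition entries t (y : {ffun 'I_t -> gT}) : {set gT} := [set y i | i : 'I_t].

(** By taking kernels, these derivations correspond to the complements of N in G
that contain A. *)
Definition compl_ders G N A :=
  [set d : {ffun gT -> gT} in derivations G N A | [forall x in N, d x == x]].

(** The n in N^t for which the entries of y n lie in the kernel of one of these
derivations: d(y_i n_i) = d(y_i) n_i when d is the identity on the abelian group
N. *)
Definition bad_lifts t G N A (y : {ffun 'I_t -> gT}) :
    {set {ffun 'I_t -> gT}} :=
  [set [ffun i => (d (y i))^-1] | d : {ffun gT -> gT} in compl_ders G N A].

Lemma cpowP t A (y : {ffun 'I_t -> gT}) :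
  reflect (forall i, y i \in A) (y \in cpow t A).
Proof. by rewrite inE; apply: ffun_onP. Qed.

Lemma card_cpow t A : #|cpow t A| = (#|A| ^ t)%N.
Proof. by rewrite cardsE card_ffun_on card_ord. Qed.

Lemma entries_sub t A (y : {ffun 'I_t -> gT}) :
  y \in cpow t A -> entries y \subset A.
Proof. by move/cpowP=> Ay; apply/subsetP=> _ /imsetP[i _ ->]. Qed.

Lemma mem_entries t (y : {ffun 'I_t -> gT}) i : y i \in entries y.
Proof. exact: imset_f. Qed.

Lemma der_eq1 G N A d :
  d \in derivations G N A -> A \subset G -> <<A>> = G -> d = 1.
Proof.
move=> Dd sAG defG; apply/ffunP=> g; rewrite oneg_ffun.
have [Gg | nGg] := boolP (g \in G); last exact: der_out Dd nGg.
by rewrite (der_triv (der_gen Dd sAG)) // defG.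
Qed.

Lemma der_entries t G N A d (y : {ffun 'I_t -> gT}) :
  d \in derivations G N A -> (forall i, d (y i) = 1) ->
  d \in derivations G N (A :|: entries y).
Proof.
move=> Dd dy; rewrite derU Dd; case/derP: Dd => d1 d2 d3 _.
by apply/derP; split=> // _ /imsetP[i _ ->].
Qed.

(** A derivation is determined by its values on generators of G. *)
Lemma der_separated t G N H (y : {ffun 'I_t -> gT}) :
    H \subset G -> y \in cpow t G -> H <*> entries y = G ->
  forall d, d \in derivations G N H -> (forall i, d (y i) = 1) -> d = 1.
Proof.
move=> sHG /entries_sub sYG defG d Dd dy.
by apply: (der_eq1 (der_entries Dd dy)); rewrite // subUset sHG.
Qed.

Lemma card_der_le t G N H (y : {ffun 'I_t -> gT}) :
    N <| G -> abelian N -> H \subset G -> y \in cpow t G ->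
    H <*> entries y = G ->
  #|derivations G N H| <= #|N| ^ t.
Proof.
move=> nNG abN sHG Gy defG; rewrite -card_cpow.
pose ev (d : {ffun gT -> gT}) : {ffun 'I_t -> gT} :=
  [ffun i => d (y i)].
have inj_ev: {in derivations G N H &, injective ev}.
  move=> d k Dd Dk /ffunP eq_dk; apply: (mulIg k^-1); rewrite mulgV.
  apply: (der_separated (N := N) sHG Gy defG);
    first by rewrite der_mul ?der_inv.
  by move=> i; have:= eq_dk i; rewrite !ffunE => ->; rewrite mulgV.
rewrite -(card_in_imset inj_ev); apply/subset_leq_card/subsetP=> _
  /imsetP[d Dd ->].
apply/cpowP=> i; rewrite ffunE (der_in Dd) //.
exact: (cpowP _ _ Gy).
Qed.

(** M :&: N is normalised by M, and by N since N is abelian. *)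
Lemma suppl_minnormal G N M :
    minnormal N G -> abelian N -> N \subset G -> M \subset G -> M * N = G ->
  M :=: G \/ M :&: N = 1.
Proof.
move=> /mingroupP[/andP[ntN nNG] minN] abN sNG sMG defG.
have [sNM | nsNM] := boolP (N \subset M).
  by left; rewrite -defG mulGSid.
right; apply/eqP; apply: contraR nsNM => ntMN.
have <-: M :&: N = N; last exact: subsetIl.
apply: minN (subsetIr _ _); rewrite ntMN -defG mul_subG //=.
  by rewrite normsI ?normG // (subset_trans sMG nNG).
by rewrite cents_norm // (subset_trans abN) // centS ?subsetIr.
Qed.

Lemma lift_or_bad t G N H (y n : {ffun 'I_t -> gT}) :
    minnormal N G -> abelian N -> N \subset G -> H \subset G ->
    y \in cpow t G -> n \in cpow t N -> (H <*> entries y) * N = G ->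
  H <*> entries (y * n) = G \/ n \in bad_lifts G N H y.
Proof.
move=> minN abN sNG sHG /cpowP Gy /cpowP Nn defG.
set M := (H <*> entries (y * n)%g)%G.
have nNG: G \subset 'N(N) by case/andP: (mingroupp minN).
have sMG: M \subset G.
  rewrite join_subG sHG; apply/subsetP=> _ /imsetP[i _ ->].
  by rewrite mulg_ffun groupM // (subsetP sNG).
have My i : y i * n i \in M.
  by rewrite -mulg_ffun; apply/(subsetP (joing_subr _ _))/mem_entries.
have defMN: M * N = G.
  apply/eqP; rewrite eqEsubset mul_subG //= -{1}defG.
  rewrite -(norm_joinEl (subset_trans sMG nNG)) mul_subG ?joing_subr //.
  rewrite join_subG (subset_trans _ (joing_subl _ _)) ?joing_subl //=.
  apply/subsetP=> _ /imsetP[i _ ->].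
  rewrite -[y i](mulgK (n i)) groupM ?groupV //.
    by apply: (subsetP (joing_subl _ _)).
  by apply: (subsetP (joing_subr _ _)).
have [defM | tiMN] := suppl_minnormal minN abN sNG sMG defMN; first by left.
have nsNG: N <| G by rewrite /normal sNG.
right; have [d Dd dN] := compl_der nsNG abN sMG tiMN defMN.
apply/imsetP; exists d.
  rewrite inE (derS _ Dd) ?joing_subl //=.
  by apply/forall_inP=> x /dN->.
apply/ffunP=> i; rewrite ffunE -{1}[y i](mulgK (n i)) (derM Dd) ?groupM
  ?groupV //.
    rewrite (der_triv Dd) // conj1g mul1g dN ?groupV ?invgK //.
  by rewrite (subsetP sNG).
by rewrite (subsetP sNG) ?groupV.
Qed.

(** Two derivations that are the identity on N differ by one that vanishes
there. *)
Lemma card_bad_lifts t G N A (y : {ffun 'I_t -> gT}) :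
    N <| G -> abelian N ->
  #|bad_lifts G N A y| <= #|derivations G N (A :|: N)|.
Proof.
move=> nNG abN; apply: leq_trans (leq_imset_card _ _) _.
have [-> | [d0 C0]] := set_0Vmem (compl_ders G N A); first by rewrite cards0.
have inj_q: injective (fun d => d0^-1 * d).
  exact: mulgI.
rewrite -(card_imset _ inj_q); apply/subset_leq_card/subsetP=> _
  /imsetP[d Cd ->].
move: C0 Cd; rewrite !inE.
move=> /andP[D0 /forall_inP N0] /andP[Dd /forall_inP Nd].
have D: d0^-1 * d \in derivations G N A by rewrite der_mul ?der_inv // inE.
have: d0^-1 * d \in derivations G N (A :|: N); last by rewrite inE.
rewrite derU D; case/derP: D => d1 d2 d3 _; apply/derP; split=> // x Nx.
by rewrite mulg_ffun invg_ffun (eqP (N0 x Nx)) (eqP (Nd x Nx)) mulVg.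
Qed.

(** Fix one derivation d0 that is the identity on N. For f in End_G(N), the
derivations with restriction f to N are the f o d0 times the derivations that
vanish on N, so all these fibres have the same size. *)
Lemma card_bad_endos t G N A (y : {ffun 'I_t -> gT}) :
    N <| G -> abelian N ->
  #|bad_lifts G N A y| * #|equi_endos G N| <= #|derivations G N A|.
Proof.
move=> nNG abN; have [->|[_ /imsetP[d0 C0 _]]] := set_0Vmem (bad_lifts G N A y).
  by rewrite cards0 mul0n.
move: C0; rewrite inE => /andP[D0 /forall_inP N0].
apply: leq_trans (leq_mul (card_bad_lifts A y nNG abN) (leqnn _)) _.
pose F (p : {ffun gT -> gT} * {ffun gT -> gT}) : {ffun gT -> gT} :=
  [ffun g => p.2 (d0 g)] * p.1.
have FN p x : p \in setX (derivations G N (A :|: N)) (equi_endos G N) ->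
    x \in N -> F p x = p.2 x.
  rewrite inE derU => /andP[/andP[_ Dp] _] Nx.
  by rewrite mulg_ffun ffunE (eqP (N0 x Nx)) (der_triv Dp) ?mulg1.
rewrite -cardsX -(@card_in_imset _ _ F).
  apply/subset_leq_card/subsetP=> d /imsetP[p].
  rewrite inE derU => /andP[/andP[Dp _] Ep] ->.
  by rewrite der_mul // der_comp.
move=> p q Xp Xq eqF; have eq2: p.2 = q.2.
  apply/ffunP=> x; have [Nx | nNx] := boolP (x \in N).
    by rewrite -FN // eqF FN.
  move: Xp Xq; rewrite [_ \in setX _ _]inE [q \in _]inE.
  move=> /andP[_ /equi_endosP[_ _ _ p0]] /andP[_ /equi_endosP[_ _ _ q0]].
  by rewrite p0 ?q0.
move: eqF; rewrite /F eq2 => /mulgI eq1.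
by case: p q eq1 eq2 {Xp Xq} => p1 p2 [q1 q2] /= -> ->.
Qed.

Lemma lift_both t G N H1 H2 (y : {ffun 'I_t -> gT}) :
    minnormal N G -> abelian N -> N \subset G -> H1 \subset G -> H2 \subset G ->
    y \in cpow t G ->
    (H1 <*> entries y) * N = G -> (H2 <*> entries y) * N = G ->
    #|bad_lifts G N H1 y :|: bad_lifts G N H2 y| < #|N| ^ t ->
  exists z, [/\ z \in cpow t G, H1 <*> entries z = G & H2 <*> entries z = G].
Proof.
move=> minN abN sNG sH1 sH2 Gy def1 def2; rewrite -card_cpow => lt_bad.
have: ~~ (cpow t N \subset bad_lifts G N H1 y :|: bad_lifts G N H2 y).
  by apply: contraL lt_bad => /subset_leq_card; rewrite -leqNgt.
case/subsetPn=> n Nn; rewrite inE => /norP[nb1 nb2]; exists (y * n); split.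
- apply/cpowP=> i; rewrite mulg_ffun groupM ?(cpowP _ _ Gy) //.
  by rewrite (subsetP sNG) ?(cpowP _ _ Nn).
- by case: (lift_or_bad minN abN sNG sH1 Gy Nn def1) nb1 => // ->.
- by case: (lift_or_bad minN abN sNG sH2 Gy Nn def2) nb2 => // ->.
Qed.

(** Each bad set fills at most a fraction 1 / |End_G(N)| of N^t; the tuples y1
and y2 serve only to bound the number of derivations. *)
Lemma lift_both_endos t G N H1 H2 (y y1 y2 : {ffun 'I_t -> gT}) :
    minnormal N G -> abelian N -> N \subset G -> H1 \subset G -> H2 \subset G ->
    2 < #|equi_endos G N| ->
    y1 \in cpow t G -> H1 <*> entries y1 = G ->
    y2 \in cpow t G -> H2 <*> entries y2 = G ->
    y \in cpow t G ->
    (H1 <*> entries y) * N = G -> (H2 <*> entries y) * N = G ->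
  exists z, [/\ z \in cpow t G, H1 <*> entries z = G & H2 <*> entries z = G].
Proof.
move=> minN abN sNG sH1 sH2 gtE Gy1 gen1 Gy2 gen2 Gy def1 def2.
apply: (lift_both minN _ _ _ _ Gy) => //.
have nsNG: N <| G by rewrite /normal sNG; case/andP: (mingroupp minN).
have le1 := leq_trans (card_bad_endos H1 y nsNG abN)
                      (card_der_le nsNG abN sH1 Gy1 gen1).
have le2 := leq_trans (card_bad_endos H2 y nsNG abN)
                      (card_der_le nsNG abN sH2 Gy2 gen2).
have leU := leq_card_setU (bad_lifts G N H1 y) (bad_lifts G N H2 y).
have gt0: 0 < #|N| ^ t by rewrite expn_gt0 cardG_gt0.
rewrite -(ltn_pmul2r (ltnW (ltnW gtE))).
apply: leq_ltn_trans (leq_mul leU (leqnn _)) _.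
rewrite mulnDl; apply: leq_ltn_trans (leq_add le1 le2) _.
by rewrite addnn -muln2 ltn_pmul2l.
Qed.

End Lifting.

(** * The socle *)

Section Socle.

Variable gT : finGroupType.
Implicit Types (G H K L M N P S W : {group gT}) (A B : {set gT}).

Definition minnormal_in N G := minnormal N G && (N \subset G).

Definition nsocle G : {set gT} := <<\bigcup_(N : {group gT} | minnormal_in N G)
  N>>.

Canonical nsocle_group G := [group of nsocle G].

Lemma minnormal_inW G N : minnormal_in N G ->
  [/\ minnormal N G, N \subset G, N :!=: 1 & N <| G].
Proof.
case/andP=> minN sNG; have /andP[ntN nNG] := mingroupp minN.
by split=> //; apply/andP.
Qed.

Lemma nsocle_max G N : minnormal_in N G -> N \subset nsocle G.
Proof. by move=> minN; apply: sub_gen; apply: (bigcup_max N). Qed.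

Lemma nsocle_sub_group G K :
  (forall N, minnormal_in N G -> N \subset K) -> nsocle G \subset K.
Proof. by move=> sNK; rewrite gen_subG; apply/bigcupsP=> N /sNK. Qed.

Lemma nsocle_normal G : nsocle G <| G.
Proof.
apply/andP; split; first by apply: nsocle_sub_group => N /andP[].
apply: norms_gen; apply: norms_bigcup; apply/bigcapsP=> N /minnormal_inW[_ _ _].
by case/andP.
Qed.

Lemma minnormal_abelian G N : solvable G -> minnormal_in N G -> abelian N.
Proof.
move=> solG /minnormal_inW[minN sNG _ _].
have [_ _ /is_abelemP[p _ /abelem_abelian]] //:=
  minnormal_solvable minN sNG solG.
Qed.

Lemma minnormal_TI G N P : minnormal_in N G -> minnormal_in P G ->
  N :=: P \/ N :&: P = 1.
Proof.
move=> /andP[/mingroupP[/andP[_ nNG] minN] _]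
  /andP[/mingroupP[/andP[_ nPG] minP] _].
have [tiNP | ntNP] := eqVneq (N :&: P) 1; [by right | left].
have nI: (N :&: P != 1) && (G \subset 'N(N :&: P)) by rewrite ntNP normsI.
by rewrite -(minN (N :&: P)%G nI (subsetIl _ _)) /=
  (minP (N :&: P)%G nI (subsetIr _ _)).
Qed.

(** Distinct minimal normal subgroups commute, as their commutator lies in their
intersection. *)
Lemma nsocle_abelian G : solvable G -> abelian (nsocle G).
Proof.
move=> solG; rewrite abelian_gen; apply/centsP=> x /bigcupP[N minN Nx].
move=> y /bigcupP[P minP Py].
have [defNP | tiNP] := minnormal_TI minN minP.
  by rewrite -defNP in Py; apply: (centsP (minnormal_abelian solG minN)).
have [[_ sNG _ /andP[_ nN]] [_ sPG _ /andP[_ nP]]] :=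
  (minnormal_inW minN, minnormal_inW minP).
have: [~: N, P] \subset [1 gT].
  rewrite -tiNP commg_subI // subsetI ?subxx ?(subset_trans sNG) //.
  by rewrite (subset_trans sPG).
by move=> /trivgP/commG1P/centsP; apply.
Qed.

(** A minimal supplement L of S meets S in a normal subgroup of G, since S is
abelian. A maximal subgroup M of G that does not contain L :&: S would make
L :&: M a smaller supplement, so L :&: S lies in Phi(G). *)
Lemma abelian_normal_splits G S :
  S <| G -> abelian S -> 'Phi(G) = 1 ->
  exists L : {group gT}, [/\ L \subset G, L :&: S = 1 & L * S = G].
Proof.
move=> /andP[sSG nSG] abS Phi1.
have [|L /mingroupP[/andP[sLG /eqP defG] minL] _] := @mingroup_exists _
  (fun A : {group gT} => (A \subset G) && (A * S == G)) G.
  by rewrite /= subxx mulGSid ?eqxx.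
exists L; split=> //; apply/eqP; apply/idPn=> ntD.
have nDG: G \subset 'N(L :&: S).
  rewrite -defG mul_subG //.
    by rewrite normsI ?normG // (subset_trans sLG).
  by rewrite cents_norm // (subset_trans abS) // centS ?subsetIr.
have: ~~ (L :&: S \subset 'Phi(G)) by rewrite Phi1 subG1.
rewrite /Frattini; apply/negP; rewrite negbK; apply/bigcapsP=> M.
case/predU1P=> [-> | maxM]; first by rewrite subIset ?sLG.
apply/idPn=> nsDM; have sMG := maxgroupp maxM.
have defMD: M * (L :&: S) = G.
  have /maxgroupP[/properP[sM _] maxM'] := maxM.
  rewrite -norm_joinEl ?(subset_trans sM) //.
  apply/eqP; rewrite eqEproper join_subG sM (subset_trans (subsetIl _ _)) //=.
  apply: contra nsDM => ltMD.
  by rewrite -(maxM' (M <*> (L :&: S))%G ltMD (joing_subl _ _)) joing_subr.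
have defL: (L :&: M) * (L :&: S) = L.
  by rewrite (group_modr M (subsetIl L S)) defMD; apply/setIidPl.
have defLM: L :&: M = L.
  apply: (minL (L :&: M)%G (introT andP _) (subsetIl _ _)) => /=.
  rewrite subIset ?sLG //; split=> //; apply/eqP.
  by rewrite -[RHS]defG -[in RHS]defL -mulgA (mulSGid (subsetIr _ _)).
by case/negP: nsDM; rewrite subIset // -defLM subsetIr.
Qed.

(** In a complement L of the socle, 'C_L(S) is normal in G and meets the socle
trivially, so it contains no minimal normal subgroup. *)
Lemma cent_nsocle G : solvable G -> 'Phi(G) = 1 ->
  'C_G(nsocle G) \subset nsocle G.
Proof.
move=> solG Phi1; have nsSG := nsocle_normal G; have abS := nsocle_abelian solG.
have [L [sLG tiLS defG]] := abelian_normal_splits nsSG abS Phi1.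
have [sSG nSG] := andP nsSG.
set S := nsocle_group G.
have nsCL: G \subset 'N('C_L(S)).
  rewrite -{1}defG mul_subG //.
    by rewrite normsI ?normG // (subset_trans sLG) // norms_cent.
  by rewrite cents_norm // centsC subsetIr.
have C1: 'C_L(S) = 1.
  apply/eqP; apply/idPn=> ntC.
  have [N minN sNC] := minnormal_exists ntC nsCL.
  have minNG: minnormal_in N G.
    by rewrite /minnormal_in minN (subset_trans sNC) // subIset ?sLG.
  have /minnormal_inW[_ _ /negP[]] := minNG.
  rewrite -subG1 -tiLS subsetI nsocle_max // andbT.
  by rewrite (subset_trans sNC) ?subsetIl.
apply/subsetP=> c /setIP[Gc Cc]; rewrite -defG in Gc.
case/mulsgP: Gc Cc => l s Ll Ss -> Cls.
have Cs: s \in 'C(S) by apply: (subsetP abS).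
have: l \in 'C_L(S) by rewrite inE Ll -(groupMr _ Cs).
by rewrite C1 => /set1P->; rewrite mul1g.
Qed.

End Socle.

(** * Endomorphisms of a minimal normal subgroup *)

Section Endos.

Variable gT : finGroupType.
Implicit Types (G N : {group gT}) (f : {ffun gT -> gT}).

Lemma endo_power G N n : G \subset 'N(N) -> abelian N ->
  [ffun x => if x \in N then x ^+ n else 1] \in equi_endos G N.
Proof.
move=> nNG abN; apply/equi_endosP; split=> [x|x y|x g|x /negbTE nNx].
- by move=> Nx; rewrite ffunE Nx groupX.
- move=> Nx Ny; rewrite !ffunE Nx Ny groupM // expgMn //.
  exact: (centsP abN).
- by move=> Nx Gg; rewrite !ffunE memJ_norm ?(subsetP nNG) // Nx conjXg.
- by rewrite ffunE nNx.
Qed.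

(** The power maps x^0 and x^1 are two different endomorphisms. *)
Lemma endo_01 G N f : G \subset 'N(N) -> abelian N -> N :!=: 1 ->
    #|equi_endos G N| <= 2 -> f \in equi_endos G N ->
  {in N, forall x, f x = 1} \/ {in N, forall x, f x = x}.
Proof.
move=> nNG abN /trivgPn[z Nz ntz] leE Ef.
pose e n : {ffun gT -> gT} := [ffun x => if x \in N then x ^+ n else 1].
have eE n x : x \in N -> e n x = x ^+ n by move=> Nx; rewrite ffunE Nx.
have [f0 | nf0] := eqVneq f (e 0%N); first by left=> x Nx; rewrite f0 eE.
have [f1 | nf1] := eqVneq f (e 1%N); first by right=> x Nx; rewrite f1 eE.
case/idPn: leE; rewrite -ltnNge; apply: (@leq_trans #|[set f; e 0%N; e 1%N]|).
  have n01: e 0%N != e 1%N.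
    by apply: contraNneq ntz => /ffunP/(_ z); rewrite !eE // expg0 expg1 => <-.
  by rewrite -setUA !cardsU1 !inE cards1 negb_or nf0 nf1 n01.
apply/subset_leq_card/subsetP=> k; rewrite !inE => /orP[/orP[]|] /eqP->.
- by rewrite inE in Ef.
- by have:= endo_power 0 nNG abN; rewrite inE.
- by have:= endo_power 1 nNG abN; rewrite inE.
Qed.

(** The endomorphism x^2 must be x^0, because it is x^1 only on the trivial
group. *)
Lemma endo_le2_abelem2 G N : solvable G -> minnormal_in N G ->
  #|equi_endos G N| <= 2 -> 2.-abelem N.
Proof.
move=> solG minN leE; have abN := minnormal_abelian solG minN.
have [minN' sNG ntN /andP[_ nNG]] := minnormal_inW minN.
apply/abelemP=> //; split=> // x Nx.
have [] := endo_01 nNG abN ntN leE (endo_power 2 nNG abN).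
  by move/(_ x Nx); rewrite ffunE Nx.
have [z Nz /negP ntz] := trivgPn _ ntN.
move/(_ z Nz); rewrite ffunE Nz expg2 => zz; case: ntz.
by rewrite -(inj_eq (mulgI z)) mulg1 zz.
Qed.

Lemma endo_ge2 G N : G \subset 'N(N) -> abelian N -> N :!=: 1 ->
  1 < #|equi_endos G N|.
Proof.
move=> nNG abN /trivgPn[z Nz ntz].
have E0 := endo_power 0 nNG abN; have E1 := endo_power 1 nNG abN.
have le2 : #|[set [ffun x => if x \in N then x ^+ 0 else 1];
    [ffun x => if x \in N then x ^+ 1 else 1]]| <= #|equi_endos G N|.
  by apply/subset_leq_card/subsetP=> f /set2P[]->.
apply: leq_trans le2; rewrite cards2 ltnS lt0b.
by apply: contraNneq ntz => /ffunP/(_ z); rewrite !ffunE Nz expg0 expg1 => <-.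
Qed.

Lemma abelem2_sq N x : 2.-abelem N -> x \in N -> x * x = 1.
Proof. by case/(abelemP (isT : prime 2)) => _ /[apply]; rewrite expg2. Qed.

End Endos.

(** * Subgroups of small index *)

Section SmallIndex.

Variable gT : finGroupType.
Implicit Types (G H K : {group gT}).

Lemma avoid_two G H1 H2 : H1 \subset G -> H2 \subset G -> exists2 g, g \in G &
  (H1 :!=: G -> g \notin H1) /\ (H2 :!=: G -> g \notin H2).
Proof.
move=> sH1 sH2.
have out K : K \subset G -> K :!=: G -> exists2 g, g \in G & g \notin K.
  move=> sK neK; have: K \proper G by rewrite properEneq neK.
  by case/properP=> _ [g Gg nKg]; exists g.
have [e1 | ne1] := eqVneq (H1 : {set gT}) G;
  have [e2 | ne2] := eqVneq (H2 : {set gT}) G.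
- by exists 1; rewrite ?group1.
- by have [g Gg n2] := out _ sH2 ne2; exists g; rewrite // ?e1 ?eqxx.
- by have [g Gg n1] := out _ sH1 ne1; exists g; rewrite // ?e2 ?eqxx.
have [[a Ga n1a] [b Gb n2b]] := (out _ sH1 ne1, out _ sH2 ne2).
have [H2a | n2a] := boolP (a \in H2); last by exists a.
have [H1b | n1b] := boolP (b \in H1); last by exists b.
by exists (a * b); [rewrite groupM | rewrite groupMr // groupMl].
Qed.

(** Adjoining an element outside each proper Hj at least doubles it. *)
Lemma index_exp2_common t G H1 H2 :
    H1 \subset G -> H2 \subset G ->
    #|G| <= #|H1| * 2 ^ t -> #|G| <= #|H2| * 2 ^ t ->
  exists y : {ffun 'I_t -> gT}, [/\ y \in cpow t G,
     H1 <*> entries y = G & H2 <*> entries y = G].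
Proof.
elim: t H1 H2 => [|t IHt] H1 H2 sH1 sH2 le1 le2.
  have full K : K \subset G -> #|G| <= #|K| * 2 ^ 0 -> K :=: G.
    by rewrite expn0 muln1 => sK leK; apply/eqP; rewrite eqEcard sK.
  exists [ffun=> 1]; split; first by apply/cpowP; case.
  - apply/eqP; rewrite eqEsubset join_subG sH1 -{2}(full _ sH1 le1) joing_subl.
    by rewrite andbT; apply/subsetP=> x /imsetP[[]].
  - apply/eqP; rewrite eqEsubset join_subG sH2 -{2}(full _ sH2 le2) joing_subl.
    by rewrite andbT; apply/subsetP=> x /imsetP[[]].
have [g Gg [n1 n2]] := avoid_two sH1 sH2.
have step K : K \subset G -> (K :!=: G -> g \notin K) ->
    #|G| <= #|K| * 2 ^ t.+1 -> #|G| <= #|K <*> <[g]>| * 2 ^ t.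
  move=> sK nKg leK; have [eK | neK] := eqVneq (K : {set gT}) G.
    rewrite (leq_trans (subset_leq_card _) (leq_pmulr _ _)) ?expn_gt0 //.
    by rewrite -{1}eK joing_subl.
  apply: leq_trans leK _; rewrite expnS mulnA leq_mul2r.
  have ltK: K \proper K <*> <[g]>.
    rewrite properE joing_subl; apply: contra (nKg neK) => /subsetP; apply.
    by apply: (subsetP (joing_subr _ _)); rewrite cycle_id.
  have ltK' := proper_card ltK; rewrite -(Lagrange (proper_sub ltK)) in ltK' *.
  by rewrite leq_mul2l -(ltn_pmul2l (cardG_gt0 K)) muln1 ltK' !orbT.
have sg K : K \subset G -> (K <*> <[g]>)%G \subset G.
  by move=> sK; rewrite join_subG sK cycle_subG.
have [y [Gy gen1 gen2]] :=
  IHt (H1 <*> <[g]>)%G (H2 <*> <[g]>)%G (sg _ sH1) (sg _ sH2)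
      (step _ sH1 n1 le1) (step _ sH2 n2 le2).
pose z : {ffun 'I_t.+1 -> gT} :=
  [ffun i => if unlift ord0 i is Some j then y j else g].
have zE: entries z = g |: entries y.
  apply/setP=> x; rewrite !inE; apply/imsetP/orP.
    case=> i _ ->; rewrite ffunE; case: unliftP => [j|] _; last by left.
    by right; apply: imset_f.
  case=> [/eqP-> | /imsetP[j _ ->]].
    by exists ord0; rewrite // ffunE unlift_none.
  by exists (lift ord0 j); rewrite // ffunE liftK.
have zG K : K <*> <[g]> <*> entries y = K <*> entries z.
  have sz: g |: entries y \subset K <*> (g |: entries y) by apply: joing_subr.
  rewrite zE; apply/eqP; rewrite eqEsubset !join_subG cycle_subG !joing_subl /=.
  rewrite (subsetP sz) ?setU11 ?(subset_trans (subsetUr _ _) sz) //=.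
  rewrite (subset_trans (joing_subl _ _) (joing_subl _ _)) subUset sub1set.
  rewrite joing_subr andbT; apply: (subsetP (joing_subl _ _)).
  by apply: (subsetP (joing_subr _ _)); rewrite cycle_id.
exists z; split; [|by rewrite -zG|by rewrite -zG].
apply/cpowP=> i; rewrite ffunE; case: unliftP => // j _.
exact: (cpowP _ _ Gy).
Qed.

Lemma abelem2_gen_card t G H (y : {ffun 'I_t -> gT}) :
  2.-abelem G -> H <*> entries y = G -> #|G| <= #|H| * 2 ^ t.
Proof.
move=> abG defG.
have sHG: H \subset G by rewrite -defG joing_subl.
have sgG: <<entries y>> \subset G by rewrite gen_subG -defG joing_subr.
have defG': H * <<entries y>> = G.
  rewrite -norm_joinEr /= ?joing_idr //.
  by rewrite (subset_trans sgG) // sub_abelian_norm ?(abelem_abelian abG).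
have abY := abelemS sgG abG.
have leY: #|<<entries y>>| <= 2 ^ t.
  rewrite (card_pgroup (abelem_pgroup abY)) leq_exp2l //.
  rewrite -(rank_abelem abY) -grank_abelian ?(abelem_abelian abY) //.
  apply: leq_trans (grank_min _) (leq_trans (leq_imset_card _ _) _).
  by rewrite card_ord.
rewrite (leq_trans _ (leq_mul (leqnn _) leY)) // -{1}defG'.
by rewrite mul_cardG leq_pmulr ?cardG_gt0.
Qed.

End SmallIndex.

(** * Derivations determined by a coprime action *)

Section CoprimeDerivations.

Variable gT : finGroupType.
Implicit Types (G H K L M N P Q S W : {group gT}) (A B : {set gT}).
Implicit Types (d k f : {ffun gT -> gT}) (g h : gT).

(** Reindexing the sum by e |-> e h and expanding d(e h) = d(e)^h d(h) gives
0 = 0^h + |Q| d(h), and |Q| is invertible on N. *)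
Lemma der_sum0_triv G N S Q d (abN : abelian N) :
    N <| G -> Q \subset G -> coprime #|Q| #|N| ->
    d \in derivations G N S ->
    (\sum_(e in Q) FiniteModule.fmod abN (d e))%R = 0%R ->
  {in Q, forall h, d h = 1}.
Proof.
move=> /andP[sNG nNG] sQG coQN Dd sum0 h Qh.
have Gh := subsetP sQG h Qh; have Ndh := der_in Dd Gh.
move: (sum0); rewrite (reindex_inj (mulIg h)) /=.
rewrite (eq_bigl (mem Q)) => [|e]; last by rewrite /= groupMr.
rewrite (eq_bigr (fun e => FiniteModule.actr (FiniteModule.fmod abN (d e)) h
                           + FiniteModule.fmod abN (d h))%R); last first.
  move=> e Qe; have Ge := subsetP sQG e Qe.
  rewrite (derM Dd) // FiniteModule.fmodM ?memJ_norm ?(subsetP nNG)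
    ?(der_in Dd) //.
  by rewrite FiniteModule.fmodJ // (subsetP nNG).
rewrite big_split /= -FiniteModule.actr_sum sum0 FiniteModule.act0r add0r.
rewrite sumr_const -FiniteModule.fmodX // => /(congr1 val).
rewrite FiniteModule.fmodK ?groupX // FiniteModule.fmval0 => /eqP.
rewrite -order_dvdn => dvQ; apply/eqP; rewrite -order_eq1 -dvdn1.
by rewrite -(eqP coQN) dvdn_gcd dvQ order_dvdG.
Qed.

(** The sum of its values over Q determines such a derivation: if that sum is 0
the derivation vanishes on Q, hence on E = S Q, and comparing d(g h) with
d(h^(g^-1) g) for h in E shows that d(g) is centralised by E. *)
Lemma card_der_coprime_le G N S Q :
    N <| G -> abelian N -> S <| G -> S \subset 'C(N) -> Q \subset G ->
    coprime #|Q| #|N| -> S * Q <| G -> 'C_N(S * Q) = 1 ->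
  #|derivations G N S| <= #|N|.
Proof.
move=> nsNG abN nsSG cSN sQG coQN nsEG C1.
have [[sNG nNG] [sSG nSG] [sEG nEG]] :=
  And3 (andP nsNG) (andP nsSG) (andP nsEG).
pose fm := FiniteModule.fmod abN.
pose a (d : {ffun gT -> gT}) := val (\sum_(e in Q) fm (d e))%R.
have inj_a: {in derivations G N S &, injective a}.
  move=> d k Dd Dk /val_inj eq_a; apply: (mulIg k^-1); rewrite mulgV.
  set x := d * k^-1; have Dx: x \in derivations G N S by rewrite der_mul
    ?der_inv.
  have xQ: {in Q, forall h, x h = 1}.
    apply: (der_sum0_triv nsNG sQG coQN Dx (abN := abN)).
    rewrite (eq_bigr (fun e => fm (d e) - fm (k e))%R); last first.
      move=> e Qe; have Ge := subsetP sQG e Qe; rewrite mulg_ffun invg_ffun.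
      by rewrite FiniteModule.fmodM ?groupV ?(der_in Dd) ?(der_in Dk) //
        FiniteModule.fmodV.
    by rewrite sumrB eq_a subrr.
  have xE: {in S * Q, forall h, x h = 1}.
    move=> _ /mulsgP[s q Ss Qq ->].
    rewrite (derM Dx (subsetP sSG s Ss) (subsetP sQG q Qq)).
    by rewrite (der_triv Dx Ss) conj1g mul1g xQ.
  apply/ffunP=> g; rewrite oneg_ffun.
  have [Gg | /(der_out Dx)//] := boolP (g \in G).
  have: x g \in 'C_N(S * Q); last by rewrite C1 => /set1P.
  rewrite inE (der_in Dx Gg); apply/centP=> h Eh; apply/commgP/conjg_fixP.
  have Eh': h ^ g^-1 \in S * Q by rewrite memJ_norm // groupV (subsetP nEG).
  have Gh := subsetP sEG h Eh; have Gh' := subsetP sEG _ Eh'.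
  have: x (g * h) = x (h ^ g^-1 * g).
    by rewrite conjgE invgK -!mulgA mulVg mulg1.
  by rewrite (derM Dx Gg Gh) (derM Dx Gh' Gg) (xE h Eh) (xE _ Eh') mulg1 conj1g
    mul1g.
rewrite -(card_in_imset inj_a); apply/subset_leq_card/subsetP=> _
  /imsetP[d _ ->].
exact: FiniteModule.fmodP.
Qed.

End CoprimeDerivations.

(** * Lifting over an endomorphism ring with two elements *)

Section TwoElements.

Variable gT : finGroupType.
Implicit Types (G H K L M N P Q S W : {group gT}) (A B : {set gT}).
Implicit Types (d k f : {ffun gT -> gT}) (g h : gT).

Lemma two_halves (T : finType) (V B1 B2 : {set T}) :
    B1 \subset V -> B2 \subset V ->
    (#|B1| * 2 <= #|V|)%N -> (#|B2| * 2 <= #|V|)%N -> #|V| <= #|B1 :|: B2| ->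
  [/\ B1 :&: B2 = set0, B1 :|: B2 = V & (#|B1| * 2)%N = #|V|].
Proof.
move=> s1 s2 le1 le2 leU; have cI := cardsUI B1 B2.
have leU': #|B1 :|: B2| <= #|V| by rewrite subset_leq_card // subUset s1.
split; [apply/eqP; rewrite -cards_eq0 | apply/eqP;
  rewrite eqEcard subUset s1 s2 | ];
  lia.
Qed.

(** The kernel of k in P and the image of P are G-invariant. *)
Lemma minnormal_der_bij G N P k :
    solvable G -> minnormal_in N G -> minnormal_in P G -> P \subset 'C(N) ->
    k \in derivations G N 1 -> ~ {in P, forall x, k x = 1} ->
  {in P &, injective k} /\ {in N, forall x, exists2 z, z \in P & k z = x}.
Proof.
move=> solG minN minP cPN Dk ntk.
have abN := minnormal_abelian solG minN.
have [mN sNG ntN nsNG] := minnormal_inW minN.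
have [mP sPG ntP nsPG] := minnormal_inW minP.
have kM := der_hom Dk sPG cPN; have kJ := der_equi abN Dk nsPG cPN.
pose f := Morphism kM.
have nkerG: G \subset 'N('ker f).
  apply/normsP=> g Gg; apply/eqP; rewrite eqEcard cardJg leqnn andbT.
  apply/subsetP=> _ /imsetP[x Kx ->].
  have Px := dom_ker Kx; have Pxg: x ^ g \in P.
    by rewrite memJ_norm // (subsetP (normal_norm nsPG)).
  apply/kerP=> //=; rewrite kJ //.
  by have /= -> := mker Kx; rewrite conj1g.
have injf: 'injm f.
  apply/idPn; rewrite subG1 => ntK; case: ntk => x Px.
  have defK: 'ker f = P.
    have /mingroupP[_ minP'] := mP.
    by apply: (minP' ('ker f)%G); rewrite /= ?ntK ?subsetIl.
  by rewrite -defK in Px; apply: (mker Px).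
have imN: f @* P = N.
  have /mingroupP[_ minN'] := mN; apply: (minN' (f @* P)%G).
    rewrite morphim_injm_eq1 // ntP; apply/normsP=> g Gg; apply/eqP.
    rewrite eqEcard cardJg leqnn andbT;
      apply/subsetP=> _ /imsetP[_ /morphimP[x _ Px ->] ->].
    rewrite /= -kJ //; apply: mem_morphim => //=;
      by rewrite memJ_norm // (subsetP (normal_norm nsPG)).
  by apply/subsetP=> _ /morphimP[x _ Px ->]; apply/(der_in Dk)/(subsetP sPG).
split; first exact: (injmP injf).
by move=> x; rewrite -{1}imN => /morphimP[z _ Pz ->]; exists z.
Qed.

(** With k as identification of P with N, the restriction of d to P becomes an
endomorphism of N. *)
Lemma der_dichotomy G N P k d :
    solvable G -> minnormal_in N G -> minnormal_in P G -> P \subset 'C(N) ->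
    #|equi_endos G N| <= 2 ->
    k \in derivations G N 1 -> ~ {in P, forall x, k x = 1} ->
    d \in derivations G N 1 ->
  {in P, forall x, d x = 1} \/ {in P, forall x, d x = k x}.
Proof.
move=> solG minN minP cPN leE Dk ntk Dd.
have [injk surjk] := minnormal_der_bij solG minN minP cPN Dk ntk.
have abN := minnormal_abelian solG minN.
have [_ sNG ntN nsNG] := minnormal_inW minN; have nNG := normal_norm nsNG.
have [_ sPG _ nsPG] := minnormal_inW minP; have nPG := normal_norm nsPG.
have kM := der_hom Dk sPG cPN; have kJ := der_equi abN Dk nsPG cPN.
have dM := der_hom Dd sPG cPN; have dJ := der_equi abN Dd nsPG cPN.
pose i x := odflt 1 [pick z in P | k z == x].
have iP x : x \in N -> i x \in P /\ k (i x) = x.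
  case/surjk=> z Pz kz; rewrite /i;
    case: pickP => [w /andP[Pw /eqP] // | /(_ z)].
  by rewrite Pz kz eqxx.
have iK z : z \in P -> i (k z) = z.
  move=> Pz; have Nkz: k z \in N by rewrite (der_in Dk) ?(subsetP sPG).
  by have [Pi ki] := iP _ Nkz; apply: injk.
pose f := [ffun x => if x \in N then d (i x) else 1].
have Ef: f \in equi_endos G N.
  apply/equi_endosP; split=> [x Nx|x y Nx Ny|x g Nx Gg|x /negbTE nNx].
  - by rewrite ffunE Nx (der_in Dd) // (subsetP sPG) //; case: (iP x Nx).
  - have [[Px kx] [Py ky]] := (iP x Nx, iP y Ny).
    rewrite !ffunE Nx Ny groupM // -dM //; congr (d _).
    by rewrite -{1}kx -{1}ky -kM // iK ?groupM.
  - have [Px kx] := iP x Nx; have Pxg: i x ^ g \in P.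
      by rewrite memJ_norm // (subsetP nPG).
    rewrite !ffunE Nx memJ_norm ?(subsetP nNG) // Nx -dJ //; congr (d _).
    by rewrite -{1}kx -kJ // iK.
  - by rewrite ffunE nNx.
have fE z : z \in P -> f (k z) = d z.
  move=> Pz; have Nkz: k z \in N by rewrite (der_in Dk) ?(subsetP sPG).
  by rewrite ffunE Nkz iK.
have [f0 | f1] := endo_01 nNG abN ntN leE Ef; [left | right] => z Pz.
  by rewrite -fE // f0 // (der_in Dk) ?(subsetP sPG).
by rewrite -fE // f1 // (der_in Dk) ?(subsetP sPG).
Qed.

Lemma card_bad_half t G N H (y y1 : {ffun 'I_t -> gT}) :
    N <| G -> abelian N -> N :!=: 1 -> H \subset G ->
    y1 \in cpow t G -> H <*> entries y1 = G ->
  (#|bad_lifts G N H y| * 2 <= #|N| ^ t)%N.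
Proof.
move=> nsNG abN ntN sHG Gy1 gen1.
apply: leq_trans (card_der_le nsNG abN sHG Gy1 gen1).
apply: leq_trans (card_bad_endos H y nsNG abN).
by rewrite leq_mul2l endo_ge2 ?orbT // normal_norm.
Qed.

Lemma bad_lifts_sub t G N A (y : {ffun 'I_t -> gT}) :
  y \in cpow t G -> bad_lifts G N A y \subset cpow t N.
Proof.
move=> /cpowP Gy; apply/subsetP=> n /imsetP[d]; rewrite inE => /andP[Dd _] ->.
by apply/cpowP=> i; rewrite ffunE groupV (der_in Dd).
Qed.

Lemma compl_dersP G N A d :
  reflect (d \in derivations G N A /\ {in N, forall x, d x = x})
          (d \in compl_ders G N A).
Proof.
rewrite [d \in compl_ders _ _ _]inE; apply: (iffP andP) => [] [Dd dN];
  split=> //.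
  by move=> x Nx; apply/eqP/(forall_inP dN).
by apply/forall_inP=> x /dN->.
Qed.

(** If <H, y n> N is not G it is a complement of P. Following the projection to
P by k gives a derivation G -> N that vanishes on H, N and y n, and agrees with
k on P. *)
Lemma good_mod_twist t G N P H k (y n : {ffun 'I_t -> gT}) :
    solvable G -> minnormal_in N G -> minnormal_in P G -> P \subset 'C(N) ->
    k \in derivations G N 1 -> H \subset G ->
    y \in cpow t G -> n \in cpow t P -> (H <*> entries y) * N = G ->
    (forall d, d \in derivations G N (H :|: N) -> {in P, forall x, d x = k x} ->
       ~ (forall i, d (y i * n i) = 1)) ->
  (H <*> entries (y * n)) * N = G.
Proof.
move=> solG minN minP cPN Dk sHG /cpowP Gy /cpowP Pn defG noder.
have [_ sNG _ nsNG] := minnormal_inW minN;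
  have abN := minnormal_abelian solG minN.
have [mP sPG ntP nsPG] := minnormal_inW minP;
  have abP := minnormal_abelian solG minP.
have [nNG nPG] := (normal_norm nsNG, normal_norm nsPG).
have kJ := der_equi abN Dk nsPG cPN; have kM := der_hom Dk sPG cPN.
set M0 := (H <*> entries (y * n)%g)%G.
have sM0G: M0 \subset G.
  rewrite join_subG sHG; apply/subsetP=> _ /imsetP[i _ ->].
  by rewrite mulg_ffun groupM // (subsetP sPG).
rewrite -[LHS]/(M0 * N) -(norm_joinEl (subset_trans sM0G nNG)).
set M := (M0 <*> N)%G; have sMG: M \subset G by rewrite join_subG sM0G.
have defMP: M * P = G.
  apply/eqP; rewrite eqEsubset mul_subG //=.
  rewrite -(norm_joinEl (subset_trans sMG nPG)) -{1}defG mul_subG //.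
    rewrite join_subG; apply/andP; split.
      by rewrite (subset_trans _ (joing_subl _ _)) //
        (subset_trans _ (joing_subl _ _)) // joing_subl.
    apply/subsetP=> _ /imsetP[i _ ->];
      rewrite -[y i](mulgK (n i)) groupM ?groupV //.
      apply: (subsetP (joing_subl _ _)); apply: (subsetP (joing_subl _ _)).
      by apply: (subsetP (joing_subr _ _)); rewrite -mulg_ffun mem_entries.
    exact: (subsetP (joing_subr _ _)).
  by rewrite (subset_trans _ (joing_subl _ _)) // joing_subr.
have [-> // | tiMP] := suppl_minnormal mP abP sPG sMG defMP.
have [e De eP] := compl_der nsPG abP sMG tiMP defMP.
have Pe g : g \in G -> e g \in P by apply: der_in De.
pose d := [ffun g => k (e g)].
have Dd: d \in derivations G N M.
  apply/derP; split=> [g Gg|g h Gg Gh|g nGg|a Ma]; rewrite !ffunE.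
  - by rewrite (der_in Dk) // (subsetP sPG) ?Pe.
  - rewrite (derM De) // kM ?kJ ?Pe // memJ_norm ?Pe //.
    exact: (subsetP nPG).
  - by rewrite (der_out De) // (der1 Dk).
  - by rewrite (der_triv De) // (der1 Dk).
have sHM: H \subset M.
  by rewrite (subset_trans _ (joing_subl _ _)) // joing_subl.
case: (noder d).
- by apply: derS Dd; rewrite subUset sHM joing_subr.
- by move=> x Px; rewrite ffunE eP.
move=> i; rewrite (der_triv Dd) //; apply: (subsetP (joing_subl _ _)).
by apply: (subsetP (joing_subr _ _)); rewrite -mulg_ffun mem_entries.
Qed.

Lemma bad_lifts_abelem2P t G N A (y n : {ffun 'I_t -> gT}) :
    2.-abelem N -> y \in cpow t G ->
  reflect (exists2 d, d \in compl_ders G N A & forall i, n i = d (y i))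
          (n \in bad_lifts G N A y).
Proof.
move=> abN2 /cpowP Gy.
have inv d i : d \in compl_ders G N A -> (d (y i))^-1 = d (y i).
  case/compl_dersP=> Dd _; apply: (mulgI (d (y i))).
  by rewrite mulgV (abelem2_sq abN2) // (der_in Dd).
apply: (iffP imsetP) => [[d Cd ->] | [d Cd nE]]; exists d => //.
  by move=> i; rewrite ffunE inv.
by apply/ffunP=> i; rewrite ffunE inv.
Qed.

Lemma compl_ders_mul G N A d k :
    N <| G -> abelian N ->
    d \in compl_ders G N A -> k \in derivations G N (A :|: N) ->
  d * k \in compl_ders G N A.
Proof.
move=> nsNG abN /compl_dersP[Dd dN]; rewrite derU => /andP[Dk kN].
apply/compl_dersP; split; first exact: der_mul.
by move=> x Nx; rewrite mulg_ffun dN // (der_triv kN) ?mulg1.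
Qed.

Lemma compl_ders_diff G N A d k :
    N <| G -> 2.-abelem N ->
    d \in compl_ders G N A -> k \in compl_ders G N A ->
  d * k \in derivations G N (A :|: N).
Proof.
move=> nsNG abN2 /compl_dersP[Dd dN] /compl_dersP[Dk kN].
have abN := abelem_abelian abN2.
have D: d * k \in derivations G N A by apply: der_mul.
rewrite derU D; case/derP: D => D1 D2 D3 _; apply/derP; split=> // x Nx.
by rewrite mulg_ffun dN // kN // (abelem2_sq abN2).
Qed.

(** Kernels of derivations are subgroups, and the minimal normal subgroups
generate the socle. *)
Lemma minnormal_detect G N A k :
    k \in derivations G N A -> k \notin derivations G N (nsocle G) ->
  exists2 P : {group gT}, minnormal_in P G & ~ {in P, forall x, k x = 1}.
Proof.
move=> Dk nSk; have [/existsP[P /andP[minP nP]] | nex] :=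
  boolP [exists P : {group gT}, minnormal_in P G && ~~
    [forall x in P, k x == 1]].
  exists P => // kP; case/negP: nP; apply/forall_inP=> x Px.
  by rewrite kP.
case/negP: nSk; case/derP: (Dk) => k1 k2 k3 _; apply/derP; split=> // x Sx.
have /subsetP/(_ x Sx): nsocle G \subset Group (der_kerP Dk).
  apply: nsocle_sub_group => P minP; apply/subsetP=> z Pz.
  have [_ sPG _ _] := minnormal_inW minP; rewrite inE (subsetP sPG) //=.
  move: nex; rewrite negb_exists => /forallP/(_ P); rewrite minP negbK.
  by move/forall_inP/(_ z Pz).
by rewrite inE => /andP[_ /eqP].
Qed.

(** Suppose that the bad sets B1 and B2 of y cover N^t, so that they are
complementary halves. The derivations that vanish on H1 and N, evaluated at y,
map onto the direction of the coset B1; the same holds for H2 and B2, and the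
two directions agree. Some k1 of the first kind is nontrivial on a minimal
normal P. For n in P^t put v_i = k1(n_i): a derivation d takes at y n the values
d(y_i) or d(y_i) v_i, according as it restricts to P as 1 or as k1. With dj the
identity on N and trivial on Hj, the choice v = d1(y) d2(y) k1(y) lies outside
the common direction, so y n is still good modulo N, and it produces an element
common to the two new bad sets. *)
Lemma lift_both_two t G N H1 H2 (y y1 y2 : {ffun 'I_t -> gT}) :
    solvable G -> minnormal_in N G -> #|equi_endos G N| <= 2 ->
    (#|derivations G N (nsocle G)| * 2 < #|N| ^ t)%N ->
    H1 \subset G -> H2 \subset G ->
    y1 \in cpow t G -> H1 <*> entries y1 = G ->
    y2 \in cpow t G -> H2 <*> entries y2 = G ->
    y \in cpow t G ->
    (H1 <*> entries y) * N = G -> (H2 <*> entries y) * N = G ->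
  exists z, [/\ z \in cpow t G, H1 <*> entries z = G & H2 <*> entries z = G].
Proof.
move=> solG minN leE ltS sH1 sH2 Gy1 gen1 Gy2 gen2 Gy def1 def2.
have [mN sNG ntN nsNG] := minnormal_inW minN.
have abN := minnormal_abelian solG minN.
have abN2 := endo_le2_abelem2 solG minN leE.
have lift z Gz := @lift_both _ t G N H1 H2 z mN abN sNG sH1 sH2 Gz.
have half1 z := card_bad_half z nsNG abN ntN sH1 Gy1 gen1.
have half2 z := card_bad_half z nsNG abN ntN sH2 Gy2 gen2.
have [lt_bad | ge_bad] := ltnP #|bad_lifts G N H1 y :|: bad_lifts G N H2 y|
  (#|N| ^ t).
  exact: (lift y).
rewrite -card_cpow in ltS half1 half2 ge_bad.
have [dis cov eq1] := two_halves (bad_lifts_sub _ _ Gy) (bad_lifts_sub _ _ Gy)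
                                 (half1 y) (half2 y) ge_bad.
rewrite setUC in ge_bad.
have [_ _ eq2] := two_halves (bad_lifts_sub _ _ Gy) (bad_lifts_sub _ _ Gy)
                             (half2 y) (half1 y) ge_bad.
pose C1 := compl_ders G N H1; pose C2 := compl_ders G N H2.
have inN A d i : d \in derivations G N A -> d (y i) \in N.
  by move/der_in; apply; apply: (cpowP _ _ Gy).
have CN A d i : d \in compl_ders G N A -> d (y i) \in N.
  by case/compl_dersP=> Dd _; apply: inN Dd.
have sq x : x \in N -> x * x = 1 by apply: abelem2_sq.
have comN a b : a \in N -> b \in N -> a * b = b * a.
  by move=> Na Nb; apply: (centsP abN).
have NI d d' : d \in C1 -> d' \in C2 -> ~ (forall i, d (y i) = d' (y i)).
  move=> Cd Cd' eq_dd'; have /setP/(_ [ffun i => d (y i)]) := dis.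
  rewrite inE in_set0 => /negbT/negP; apply; apply/andP.
  split; apply/(bad_lifts_abelem2P _ _ abN2 Gy); [exists d | exists d'] => // i;
    by rewrite ffunE.
have COV n : n \in cpow t N -> (exists2 d, d \in C1 & forall i, n i = d (y i))
  \/
                               (exists2 d, d \in C2 & forall i, n i = d (y i)).
  by rewrite -cov => /setUP[] /(bad_lifts_abelem2P _ _ abN2 Gy); [left | right].
have gtV : 0 < #|cpow t N| by rewrite card_cpow expn_gt0 cardG_gt0.
have [d10 C10] : exists d, d \in C1.
  have: 0 < #|bad_lifts G N H1 y| by rewrite -(ltn_pmul2r (isT : 0 < 2)) eq1.
  by case/card_gt0P=> _ /imsetP[d Cd _]; exists d.
have [d20 C20] : exists d, d \in C2.
  have: 0 < #|bad_lifts G N H2 y| by rewrite -(ltn_pmul2r (isT : 0 < 2)) eq2.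
  by case/card_gt0P=> _ /imsetP[d Cd _]; exists d.
have [k1 Dk1 nSk1] : exists2 k, k \in derivations G N (H1 :|: N)
                              & k \notin derivations G N (nsocle G).
  apply/subsetPn; apply: contraL ltS => /subset_leq_card leS.
  by rewrite -leqNgt -eq1 leq_mul2r
    (leq_trans (card_bad_lifts _ _ nsNG abN) leS).
have [P minP ntk] := minnormal_detect Dk1 nSk1.
have [_ sPG _ nsPG] := minnormal_inW minP.
have cPN : P \subset 'C(N).
  rewrite (subset_trans (nsocle_max minP)) //
    (subset_trans (nsocle_abelian solG)) //.
  by rewrite centS // nsocle_max.
have D1 A d : d \in derivations G N A -> d \in derivations G N 1.
  move=> Dd; case/derP: (Dd) => a b c _; apply/derP; split=> // x /set1P->.
  exact: der1 Dd.
have DC A d : d \in compl_ders G N A -> d \in derivations G N 1.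
  by case/compl_dersP=> /D1.
have [_ surjk] := minnormal_der_bij solG minN minP cPN (D1 _ _ Dk1) ntk.
have dich d :=
  @der_dichotomy G N P k1 d solG minN minP cPN leE (D1 _ _ Dk1) ntk.
(* Multiplying by k1 exchanges the two possible restrictions to P. *)
have [d1 Cd1 d1P] : exists2 d, d \in C1 & {in P, forall x, d x = 1}.
  have [d0P | dkP] := dich _ (DC _ _ C10); first by exists d10.
  exists (d10 * k1) => [|x Px]; first exact: compl_ders_mul.
  by rewrite mulg_ffun dkP // sq // (der_in Dk1) // (subsetP sPG).
(* The direction of B1 is contained in that of B2: translating d20 by an element
of the former stays outside B1. *)
have U12 k : k \in derivations G N (H1 :|: N) ->
    exists2 k', k' \in derivations G N (H2 :|: N) & forall i, k' (y i) = k
      (y i).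
  move=> Dk; pose n := [ffun i => d20 (y i) * k (y i)].
  have Nn : n \in cpow t N.
    by apply/cpowP=> i; rewrite ffunE groupM ?(inN _ _ _ Dk) ?(CN _ _ _ C20).
  case: (COV n Nn) => [] [d Cd nE].
    case: (NI (d * k) d20) => // [|i]; first exact: compl_ders_mul.
    rewrite mulg_ffun -nE ffunE -mulgA sq ?mulg1 //; exact: inN Dk.
  exists (d20 * d) => [|i]; first exact: compl_ders_diff.
  by rewrite mulg_ffun -nE ffunE mulgA sq ?mul1g // (CN _ _ _ C20).
(* This alternative decides below which of d1(y) and d2(y) becomes the common
element. *)
have [d2 Cd2 d2P] : exists2 d2, d2 \in C2 & {in P, forall x, d2 x = 1} \/
    (forall d, d \in C2 -> {in P, forall x, d x = k1 x}).
  have [/exists_inP[d Cd /forall_inP dP] | nex] :=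
    boolP [exists d in C2, [forall x in P, d x == 1]].
    by exists d => //; left=> x /dP/eqP.
  exists d20 => //; right=> d Cd; have [d0 | //] := dich _ (DC _ _ Cd).
  case/negP: nex; apply/exists_inP; exists d => //.
  by apply/forall_inP=> x /d0->.
pose v i := d1 (y i) * d2 (y i) * k1 (y i).
have Nv i : v i \in N by rewrite !groupM ?(inN _ _ _ Dk1) ?(CN _ _ _ Cd1)
  ?(CN _ _ _ Cd2).
have [n0 Pn0 kn0] := fin_all_exists2 (fun i => surjk (v i) (Nv i)).
pose n : {ffun 'I_t -> gT} := [ffun i => n0 i].
have Pn i : n i \in P by rewrite ffunE.
have kn i : k1 (n i) = v i by rewrite ffunE.
have cPn : n \in cpow t P by apply/cpowP.
have evE A d i : d \in derivations G N A -> d (y i * n i) = d (y i) * d (n i).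
  move=> Dd; rewrite (derM Dd (cpowP _ _ Gy i) (subsetP sPG _ (Pn i))).
  congr (_ * _); apply/conjg_fixP/commgP/esym/(centsP cPN) => //.
  exact: inN Dd.
have Gy' : y * n \in cpow t G.
  by apply/cpowP=> i; rewrite mulg_ffun groupM ?(cpowP _ _ Gy) ?(subsetP sPG).
have vE (d : {ffun gT -> gT}) i : d (y i) \in N -> d (y i) * v i = 1 ->
  d (y i) = v i.
  by move=> Nd dv; apply: (mulIg (v i)); rewrite dv sq.
have cancel3 a b c : a \in N -> b \in N -> c \in N -> a * c * (a * b * c) = b.
  move=> Na Nb Nc; rewrite (comN a c) // -(mulgA a b c) (comN b c) // -!mulgA.
  by rewrite (mulgA a a) sq // mul1g mulgA sq // mul1g.
have Nd1 i := CN _ _ i Cd1; have Nd2 i := CN _ _ i Cd2;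
  have Nk1 i := inN _ _ i Dk1.
have good1 : (H1 <*> entries (y * n)) * N = G.
  apply: (good_mod_twist solG minN minP cPN (D1 _ _ Dk1) sH1 Gy cPn def1).
  move=> d Dd dP d_y.
  case: (NI (d1 * k1 * d) d2) => // [|i].
    by apply: compl_ders_mul => //; apply: compl_ders_mul.
  have := d_y i; rewrite (evE _ _ _ Dd) (dP _ (Pn i)) kn =>
    /(vE _ _ (inN _ _ _ Dd)) dE.
  by rewrite !mulg_ffun dE /v cancel3.
have good2 : (H2 <*> entries (y * n)) * N = G.
  apply: (good_mod_twist solG minN minP cPN (D1 _ _ Dk1) sH2 Gy cPn def2).
  move=> d Dd dP d_y.
  case: (NI (d1 * k1) (d2 * d)) => // [||i].
  - exact: compl_ders_mul.
  - exact: compl_ders_mul.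
  have := d_y i; rewrite (evE _ _ _ Dd) (dP _ (Pn i)) kn =>
    /(vE _ _ (inN _ _ _ Dd)) dE.
  rewrite !mulg_ffun dE /v (comN (d1 _)) // -!mulgA [RHS]mulgA.
  by rewrite sq // mul1g.
apply: (lift _ Gy' good1 good2); rewrite -card_cpow ltnNge; apply/negP=> ge'.
have [dis' _ _] := two_halves (bad_lifts_sub _ _ Gy') (bad_lifts_sub _ _ Gy')
                             (half1 _) (half2 _) ge'.
have NI' d d' : d \in C1 -> d' \in C2 ->
  ~ (forall i, d (y i * n i) = d' (y i * n i)).
  move=> Cd Cd' eq_dd'; have /setP/(_ [ffun i => d (y i * n i)]) := dis'.
  rewrite inE in_set0 => /negbT/negP; apply; apply/andP.
  split; apply/(bad_lifts_abelem2P _ _ abN2 Gy');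
    [exists d | exists d'] => // i;
    by rewrite ffunE mulg_ffun.
(* At y n, the derivation d1 k1 takes the values d2(y), and so does d2 if it is
trivial on P. Otherwise d2 k' restricts to k1 on P, where k' equals k1 at y, and
takes the values d1(y). *)
case: d2P => [d2P | C2P].
  case: (NI' (d1 * k1) d2) => // [|i]; first exact: compl_ders_mul.
  rewrite mulg_ffun (evE _ _ _ (DC _ _ Cd1)) (evE _ _ _ (DC _ _ Cd2))
    (evE _ _ _ Dk1).
  by rewrite (d1P _ (Pn i)) (d2P _ (Pn i)) kn !mulg1 /v mulgA cancel3.
have [k' Dk' k'E] := U12 _ Dk1.
have Cd2' : d2 * k' \in C2 by apply: compl_ders_mul.
case: (NI' d1 (d2 * k')) => // i.
rewrite (evE _ _ _ (DC _ _ Cd1)) (evE _ _ _ (DC _ _ Cd2')).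
rewrite (d1P _ (Pn i)) (C2P _ Cd2' _ (Pn i)) kn.
by rewrite mulg1 mulg_ffun k'E /v (comN (d1 _)) ?cancel3.
Qed.

End TwoElements.

(** * One step of the descent *)

Section Step.

Variable gT : finGroupType.
Implicit Types (E G H K L M N P Q S : {group gT}).

Lemma nsocle_abelem2 G : solvable G ->
    (forall N, minnormal_in N G -> #|equi_endos G N| <= 2) ->
  2.-abelem (nsocle G).
Proof.
move=> solG leE; have abS := nsocle_abelian solG.
apply/abelemP=> //; split=> // x Sx.
have gS: group_set [set z in nsocle G | z ^+ 2 == 1].
  apply/group_setP; split; first by rewrite inE group1 expg1n eqxx.
  move=> a b; rewrite !inE => /andP[Sa /eqP a2] /andP[Sb /eqP b2].
  have cab: commute a b by apply: (centsP abS).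
  by rewrite groupM // expgMn // a2 b2 mulg1 eqxx.
have /subsetP/(_ x Sx): nsocle G \subset Group gS.
  apply: nsocle_sub_group => N minN; apply/subsetP=> z Nz.
  rewrite inE (subsetP (nsocle_max minN)) //= expg2.
  by rewrite (abelem2_sq (endo_le2_abelem2 solG minN (leE N minN))).
by rewrite inE => /andP[_ /eqP].
Qed.

(** Otherwise E is a 2-group and its normal subgroup N meets the centre of E. *)
Lemma odd_chief_above_socle G E N (q : nat) :
    solvable G -> 2.-abelem (nsocle G) -> nsocle G \subset E -> E <| G ->
    q.-group (E / nsocle G) -> prime q -> minnormal_in N G -> 'C_N(E) = 1 ->
  odd #|E / nsocle G|.
Proof.
move=> solG abS sSE nsEG qE pr_q minN C1;
  have [_ sNG ntN nsNG] := minnormal_inW minN.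
have [q2 | odd_q] := even_prime pr_q; last first.
  by case/p_natP: qE => m ->; rewrite oddX odd_q orbT.
rewrite {q pr_q}q2 in qE; have nSE :=
  subset_trans (normal_sub nsEG) (normal_norm (nsocle_normal G)).
have pE: 2.-group E.
  rewrite /pgroup -(Lagrange sSE) pnatM; have:= abelem_pgroup abS.
  by rewrite /pgroup => ->; rewrite -card_quotient.
have sNE: N \subset E by apply: subset_trans (nsocle_max minN) sSE.
have nsNE: N <| E := normalS sNE (normal_sub nsEG) nsNG.
case/negP: (meet_center_nil (pgroup_nil pE) nsNE ntN).
by rewrite -subG1 -C1 setIS // subsetIr.
Qed.

(** A group of order 2 has no nontrivial automorphism. *)
Lemma minnormal_not_central_gt2 G E N :
    minnormal_in N G -> E <| G -> ~~ (E \subset 'C(N)) -> 2 < #|N|.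
Proof.
move=> minN nsEG; have [_ sNG ntN nsNG] := minnormal_inW minN.
apply: contraR; rewrite -leqNgt => leN.
have le1: #|N^#| <= 1.
  by move: leN; rewrite (cardsD1 1 N) group1 ltnS.
apply/centsP=> g Eg x Nx; apply: commute_sym; apply/commgP/conjg_fixP.
have [-> | ntx] := eqVneq x 1; first by rewrite conj1g.
have Nxg : x ^ g \in N.
  by rewrite memJ_norm // (subsetP (normal_norm nsNG))
    ?(subsetP (normal_sub nsEG)).
by apply: (card_le1_eqP le1); rewrite !inE ?conjg_eq1 ntx.
Qed.

(** The cases are: Phi(G) nontrivial; some minimal normal subgroup with a third
endomorphism; G elementary abelian of exponent 2; and the remaining one, in
which either t <= 1 or a noncentral N with two endomorphisms is chosen so that
few derivations G -> N vanish on the socle. *)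
Lemma common_step t G H1 H2 (y1 y2 : {ffun 'I_t -> gT}) :
    solvable G -> G :!=: 1 -> H1 \subset G -> H2 \subset G ->
    y1 \in cpow t G -> H1 <*> entries y1 = G ->
    y2 \in cpow t G -> H2 <*> entries y2 = G ->
    (t = 1%N -> forall N, minnormal_in N G -> [splits G, over N] ->
       ~~ (G \subset 'C(N)) -> 2 < #|equi_endos G N|) ->
    (forall N, N <| G -> N :!=: 1 -> exists y : {ffun 'I_t -> gT},
       [/\ y \in cpow t G, (H1 <*> entries y) * N = G
         & (H2 <*> entries y) * N = G]) ->
  exists y : {ffun 'I_t -> gT},
    [/\ y \in cpow t G, H1 <*> entries y = G & H2 <*> entries y = G].
Proof.
move=> solG ntG sH1 sH2 Gy1 gen1 Gy2 gen2 gtE1 IH.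
have [Phi1 | ntPhi] := eqVneq 'Phi(G) 1; last first.
  have [y [Gy def1 def2]] := IH _ (Phi_normal G) ntPhi; exists y.
  have gen H : H <*> entries y * 'Phi(G) = G -> H <*> entries y = G.
    move=> def; rewrite -[LHS]genGid; apply: Phi_nongen; apply/eqP.
    have sHYG: H <*> entries y \subset G by rewrite -def mulG_subl.
    rewrite eqEsubset join_subG Phi_sub sHYG /=.
    have: H <*> entries y * 'Phi(G) \subset 'Phi(G) <*> (H <*> entries y).
      by rewrite mul_subG ?joing_subl ?joing_subr.
    by rewrite def.
  by split=> //; apply: gen.
have [/existsP[N /andP[minN gtE]] | nex] :=
  boolP [exists N : {group gT}, minnormal_in N G && (2 < #|equi_endos G N|)].
  have [mN sNG ntN nsNG] := minnormal_inW minN;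
    have abN := minnormal_abelian solG minN.
  have [y [Gy def1 def2]] := IH N nsNG ntN.
  exact: (lift_both_endos mN abN sNG sH1 sH2 gtE Gy1 gen1 Gy2 gen2 Gy def1
    def2).
have leE N : minnormal_in N G -> #|equi_endos G N| <= 2.
  move=> minN; rewrite leqNgt; apply: contra nex => gtE.
  by apply/existsP; exists N; rewrite minN.
have abS := nsocle_abelem2 solG leE; have nsSG := nsocle_normal G.
have [sSG nSG] := andP nsSG; have abS' := abelem_abelian abS.
have [defS | neS] := eqVneq (nsocle G) G.
  rewrite defS in abS.
  exact: index_exp2_common sH1 sH2 (abelem2_gen_card abS gen1)
    (abelem2_gen_card abS gen2).
have ntGS: G / nsocle G != 1.
  by rewrite -subG1 quotient_sub1 //; apply: contra neS => sGS;
    rewrite eqEsubset sSG.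
(* The socle S is its own centraliser, so a minimal E / S acts nontrivially on
some N; it then acts without fixed points on N and has order coprime to |N|. *)
have [Eb minEb sEbG] := minnormal_exists ntGS (normG (G / nsocle G)).
have [ntEb nEb] := andP (mingroupp minEb).
have nsEb : Eb <| G / nsocle G by rewrite /normal sEbG.
have [E defEb sSE nsEG] := inv_quotientN nsSG nsEb.
have [_ _ /is_abelemP[q pr_q abEb]] :=
  minnormal_solvable minEb sEbG (quotient_sol _ solG).
have [N minN nCN] : exists2 N, minnormal_in N G & ~~ (E \subset 'C(N)).
  have [/existsP[N /andP[]] | nexN] :=
    boolP [exists N : {group gT}, minnormal_in N G && ~~ (E \subset 'C(N))].
    by exists N.
  case/negP: ntEb; rewrite defEb -subG1 quotient_sub1.
    apply: subset_trans (cent_nsocle solG Phi1); rewrite subsetI normal_sub //.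
    rewrite centsC; apply: nsocle_sub_group => N minN; rewrite centsC.
    by move: nexN; rewrite negb_exists => /forallP/(_ N); rewrite minN negbK.
  exact: subset_trans (normal_sub nsEG) nSG.
have [mN sNG ntN nsNG] := minnormal_inW minN;
  have abN := minnormal_abelian solG minN.
have abN2 := endo_le2_abelem2 solG minN (leE N minN).
have nCGN : ~~ (G \subset 'C(N)).
  by apply: contra nCN; apply: subset_trans (normal_sub nsEG).
have splN : [splits G, over N].
  have [L [sLG tiLN defG]] := abelian_normal_splits nsNG abN Phi1.
  apply/splitsP; exists L; apply/complP; split; first by rewrite setIC.
  by rewrite -normC // (subset_trans sLG) // normal_norm.
have [t0 | t_gt0] := posnP t.
  exists y1; split=> //; have -> // : y1 = y2.
  by apply/ffunP=> -[m lt_mt]; exfalso; move: lt_mt; rewrite t0.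
have [t1 | t_gt1] := eqVneq t 1%N.
  by have:= gtE1 t1 N minN splN nCGN; rewrite ltnNge leE.
have [y [Gy def1 def2]] := IH N nsNG ntN.
apply: (lift_both_two solG minN (leE N minN) _ sH1 sH2 Gy1 gen1 Gy2 gen2 Gy)
  => //.
have C1 : 'C_N(E) = 1.
  apply/eqP; apply: contraR nCN => ntC.
  have /mingroupP[_ minN'] := mN.
  rewrite centsC; have <- : 'C_N(E) = N; last exact: subsetIr.
  apply: minN' (subsetIl _ _); rewrite ntC normsI ?norms_cent //;
    exact: normal_norm.
have [L [sLG tiLS defG]] := abelian_normal_splits nsSG abS' Phi1.
have defE : nsocle G * (E :&: L) = E.
  rewrite setIC group_modl // -(normC (subset_trans sLG nSG)) defG.
  exact/setIidPr/normal_sub.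
have coQN : coprime #|E :&: L| #|N|.
  have cardQ : #|E :&: L| = #|E / nsocle G|.
    have tiSQ : nsocle G :&: (E :&: L) = 1.
      by rewrite setIC -setIA tiLS; apply/setIidPr; rewrite sub1G.
    rewrite card_quotient ?(subset_trans (normal_sub nsEG)) //.
    by rewrite -divgS // -{2}defE TI_cardMg // mulKn ?cardG_gt0.
  have qE : q.-group (E / nsocle G) by rewrite -defEb (abelem_pgroup abEb).
  have oddQ := odd_chief_above_socle solG abS sSE nsEG qE pr_q minN C1.
  rewrite cardQ coprime_sym; have [m ->] := p_natP (abelem_pgroup abN2).
  by rewrite coprimeXl // coprime2n.
have leZ : #|derivations G N (nsocle G)| <= #|N|.
  apply: (@card_der_coprime_le _ G N (nsocle_group G) (E :&: L)) => //=.
  - by rewrite (subset_trans abS') // centS // nsocle_max.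
  - by rewrite subIset // normal_sub.
  - by rewrite defE.
  - by rewrite defE.
have gt3 : 3 < #|N|.
  have := minnormal_not_central_gt2 minN nsEG nCN.
  have [m ->] := p_natP (abelem_pgroup abN2).
  by case: m => [|[|m]] //; rewrite (@leq_exp2l 2 2).
apply: leq_ltn_trans (leq_mul leZ (leqnn 2)) _.
apply: (@leq_trans (#|N| ^ 2)).
  by rewrite -mulnn ltn_mul2l cardG_gt0 (ltn_trans _ gt3).
by rewrite leq_pexp2l // ltn_neqAle eq_sym t_gt1.
Qed.

End Step.

(** * Descent along the normal subgroups *)

Section Descent.

Variable gT : finGroupType.
Implicit Types (G H K M : {group gT}).

Definition quo_tuple t M (y : {ffun 'I_t -> gT}) : {ffun 'I_t -> coset_of M} :=
  [ffun i => coset M (y i)].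

Lemma quo_tuple_in t M G (y : {ffun 'I_t -> gT}) :
  M <| G -> y \in cpow t G -> quo_tuple M y \in cpow t (G / M).
Proof.
move=> /andP[_ nMG] /cpowP Gy; apply/cpowP=> i; rewrite ffunE.
by rewrite mem_quotient.
Qed.

Lemma quotient_entries t M G H (y : {ffun 'I_t -> gT}) :
    M <| G -> H \subset G -> y \in cpow t G ->
  (H <*> entries y) / M = (H / M) <*> entries (quo_tuple M y).
Proof.
move=> /andP[_ nMG] sHG Gy; have sYG := entries_sub Gy.
rewrite quotientY ?(subset_trans sHG) ?(subset_trans sYG) //.
congr (_ <*> _); rewrite /quotient morphimEsub ?(subset_trans sYG) //.
by rewrite -imset_comp; apply: eq_imset => i; rewrite /= ffunE.
Qed.

(** Starting from the normal subgroup G, each proper M is reached by one step in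
G / M, as nontrivial normal subgroups of G / M come from normal subgroups of G
larger than M. *)
Lemma common_completion t G H1 H2 (y1 y2 : {ffun 'I_t -> gT}) :
    solvable G -> H1 \subset G -> H2 \subset G ->
    y1 \in cpow t G -> H1 <*> entries y1 = G ->
    y2 \in cpow t G -> H2 <*> entries y2 = G ->
    (t = 1%N -> forall M (N : {group coset_of M}), M <| G ->
       minnormal_in N (G / M) -> [splits G / M, over N] ->
       ~~ (G / M \subset 'C(N)) -> 2 < #|equi_endos (G / M) N|) ->
  exists y : {ffun 'I_t -> gT},
    [/\ y \in cpow t G, H1 <*> entries y = G & H2 <*> entries y = G].
Proof.
move=> solG sH1 sH2 Gy1 gen1 Gy2 gen2 gtE.
suffices descent M : M <| G -> exists y : {ffun 'I_t -> gT},
    [/\ y \in cpow t G, (H1 <*> entries y) * M = G & (H2 <*> entries y) * M =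
      G].
  have [y [Gy def1 def2]] := descent 1%G (normal1 G).
  by exists y; rewrite !mulg1 in def1 def2.
have [m] := ubnP (#|G| - #|M|); elim: m M => // m IHm M lt_m nsMG.
have [sMG nMG] := andP nsMG.
have sYG H y : H \subset G -> y \in cpow t G -> H <*> entries y \subset G.
  by move=> sH Gy; rewrite join_subG sH entries_sub.
have [eqMG | neMG] := eqVneq (M : {set gT}) G.
  by exists y1; split=> //; rewrite eqMG mulSGid ?sYG.
have ltMG: #|M| < #|G| by rewrite proper_card // properEneq neMG.
have ntGM: (G / M)%G :!=: 1.
  by rewrite -subG1 quotient_sub1 //; apply: contra neMG => sGM;
    rewrite eqEsubset sMG.
have genM H y : H \subset G -> y \in cpow t G -> H <*> entries y = G ->
    (H / M) <*> entries (quo_tuple M y) = G / M.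
  by move=> sH Gy def; rewrite -(quotient_entries nsMG) // def.
have [] // := @common_step _ t (G / M) (H1 / M) (H2 / M) (quo_tuple M y1)
  (quo_tuple M y2)
  (quotient_sol _ solG) ntGM (quotientS _ sH1) (quotientS _ sH2)
  (quo_tuple_in nsMG Gy1) (genM _ _ sH1 Gy1 gen1) (quo_tuple_in nsMG Gy2)
    (genM _ _ sH2 Gy2 gen2).
- by move=> t1 N; apply: gtE.
- move=> Nb nsNb ntNb; have [K defNb sMK nsKG] := inv_quotientN nsMG nsNb.
  have ltMK: #|M| < #|K|.
    apply: proper_card; rewrite properEneq sMK andbT;
      apply: contraNneq ntNb => eqMK.
    by rewrite defNb -eqMK trivg_quotient.
  have lt_m' : #|G| - #|K| < m by apply: leq_trans (ltn_sub2l ltMG ltMK) lt_m.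
  have [y [Gy def1 def2]] := IHm K lt_m' nsKG.
  exists (quo_tuple M y); split; first exact: quo_tuple_in.
  - rewrite -(quotient_entries nsMG) // defNb -quotientMl ?def1 //.
    by rewrite (subset_trans (sYG _ _ sH1 Gy)).
  - rewrite -(quotient_entries nsMG) // defNb -quotientMl ?def2 //.
    by rewrite (subset_trans (sYG _ _ sH2 Gy)).
move=> zb [/cpowP Gzb gen1b gen2b].
have lift i : exists2 z, z \in G & coset M z = zb i.
  by have /morphimP[z _ Gz ->] := Gzb i; exists z.
have [z0 Gz0 cz0] := fin_all_exists2 lift.
pose z : {ffun 'I_t -> gT} := [ffun i => z0 i].
have Gz : z \in cpow t G by apply/cpowP=> i; rewrite ffunE.
have qz : quo_tuple M z = zb by apply/ffunP=> i; rewrite !ffunE.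
have back H : H \subset G -> (H / M) <*> entries zb = G / M ->
  H <*> entries z * M = G.
  move=> sH; rewrite -qz -(quotient_entries nsMG) // => eqM.
  have nHY := subset_trans (sYG _ _ sH Gz) nMG.
  by rewrite (normC nHY) -quotientK // eqM quotientGK.
by exists z; split=> //; apply: back.
Qed.

End Descent.

(** * Chief factors as abstract modules *)

Section ChiefModule.

Variables (gT : finGroupType) (G M : {group gT}) (N : {group coset_of M}).
Hypotheses (nsMG : M <| G) (nNG : G / M \subset 'N(N)).

(** The action of an element off G is trivial because conjugation by it need not
preserve N. *)
Definition factor_act (a : [subg N]) (g : gT) : [subg N] :=
  if g \in G then subg N (sgval a ^ coset M g) else a.

Lemma factor_actE a g : g \in G -> sgval (factor_act a g) = sgval a ^ coset M g.
Proof.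
move=> Gg; rewrite /factor_act Gg subgK // memJ_norm ?subgP //.
by rewrite (subsetP nNG) // mem_quotient.
Qed.

Lemma factor_act_is_action : is_action G factor_act.
Proof.
split=> [g a b eq_ab | a g h Gg Gh].
  have [Gg | nGg] := boolP (g \in G); last first.
    by move: eq_ab; rewrite /factor_act (negbTE nGg).
  by apply: val_inj; apply: (conjg_inj (coset M g));
    rewrite /= -!factor_actE ?eq_ab.
apply: val_inj; rewrite /= !factor_actE ?groupM // coset_morphM ?conjgM //;
  exact: (subsetP (normal_norm nsMG)).
Qed.

Definition factor_action := Action factor_act_is_action.

Lemma factor_is_groupAction : is_groupAction [set: [subg N]] factor_action.
Proof.
move=> g Gg; rewrite inE; apply/andP; split; first by apply/subsetP=> a;
  rewrite inE.
apply/morphicP=> a b _ _; rewrite !actpermE /=; apply: val_inj.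
by rewrite /= !factor_actE //= conjMg.
Qed.

Definition factor_module := GroupAction factor_is_groupAction.

Lemma factor_moduleE a g : g \in G ->
  sgval (factor_module a g) = sgval a ^ coset M g.
Proof. exact: factor_actE. Qed.

Lemma factor_module_irr :
    minnormal N (G / M) -> abelian N -> ~~ (G / M \subset 'C(N)) ->
  nontrivial_irr_module factor_module.
Proof.
move=> /mingroupP[/andP[ntN _] minN] abN ncN; split.
- apply/centsP=> a _ b _; apply: val_inj => /=.
  by apply: (centsP abN); apply: subgP.
- apply/mingroupP; split=> [|B /andP[/trivgPn[b Bb ntb] actB] _].
    have [z Nz ntz] := trivgPn _ ntN; apply/andP; split.
      apply/trivgPn; exists (subg N z); rewrite ?inE //.
      by apply: contraNneq ntz => z1; rewrite -(subgK z Nz) z1.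
    apply/subsetP=> g Gg; rewrite 2!inE Gg; apply/subsetP=> a; by rewrite !inE.
  have sCN : sgval @* B \subset N.
    by apply/subsetP=> _ /morphimP[a _ _ ->]; apply: subgP.
  have defC : sgval @* B = N.
    apply: (minN (sgval @* B)%G) => //; apply/andP; split.
      apply/trivgPn; exists (sgval b); first by rewrite mem_morphim ?inE.
      by apply: contraNneq ntb => b1; apply/eqP/val_inj.
    apply/subsetP=> _ /morphimP[g _ Gg ->].
    rewrite inE; apply/subsetP=> _ /imsetP[_ /morphimP[a _ Ba ->] ->].
    rewrite /= -factor_moduleE //; apply: mem_morphim; rewrite ?inE //.
    by rewrite (astabs_act _ (subsetP actB g Gg)).
  apply/setP=> a; rewrite inE; have: sgval a \in sgval @* B by rewrite defC
    subgP.
  by case/morphimP=> c _ Bc /val_inj->.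
apply: contra ncN => cG; apply/centsP=> _ /morphimP[g _ Gg ->] x Nx.
apply: commute_sym; apply/commgP/conjg_fixP.
have := congr1 (@sgval _ _) (astab_act (subsetP cG g Gg) (in_setT (subg N x))).
by rewrite factor_moduleE // subgK.
Qed.

End ChiefModule.

Section EndModule.

Variables (gT : finGroupType) (G X Y : {group gT}) (A : finGroupType).
Variable to : groupAction G [set: A].
Hypothesis nXG : G / Y \subset 'N(X / Y).

(** The isomorphism f transports endomorphisms in both directions. *)
Lemma card_End_module :
  module_isog_factor X Y to -> #|End_module to| = #|equi_endos (G / Y) (X / Y)|.
Proof.
case=> f /isomP[injf imf] fJ.
have fM a b : f (a * b) = f a * f b by rewrite morphM ?inE.
have fX a : f a \in X / Y by rewrite -imf mem_morphim ?inE.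
have fI : injective f by move=> a b; apply: (injmP injf); rewrite inE.
pose r := invm injf.
have rK x : x \in X / Y -> f (r x) = x by rewrite -imf; apply: invmK.
have fK a : r (f a) = a by rewrite /r invmE ?inE.
have XJ x g : x \in X / Y -> g \in G -> x ^ coset Y g \in X / Y.
  by move=> Xx Gg; rewrite memJ_norm // (subsetP nXG) ?mem_quotient.
have rM x y : x \in X / Y -> y \in X / Y -> r (x * y) = r x * r y.
  by move=> Xx Xy; apply: fI; rewrite fM !rK ?groupM.
have rJ x g : x \in X / Y -> g \in G -> r (x ^ coset Y g) = to (r x) g.
  by move=> Xx Gg; apply: fI; rewrite fJ // !rK ?XJ.
apply/eqP; rewrite eqn_leq; apply/andP; split.
  pose F (e : {ffun A -> A}) : {ffun coset_of Y -> coset_of Y} :=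
    [ffun x => if x \in X / Y then f (e (r x)) else 1].
  have FE e x : x \in X / Y -> F e x = f (e (r x)) by move=> Xx;
    rewrite ffunE Xx.
  have injF : injective F.
    move=> e e' eqF; apply/ffunP=> a; apply: fI.
    by rewrite -[a]fK -!FE ?eqF.
  rewrite -(card_imset _ injF); apply/subset_leq_card/subsetP=> h /imsetP[e].
  rewrite inE => /andP[/forallP eM /forallP eJ] ->.
  apply/equi_endosP; split=> [x Xx|x y Xx Xy|x gb Xx|x /negbTE nXx].
  - by rewrite FE.
  - rewrite !FE ?groupM // rM // -fM.
    by have /forallP/(_ (r y))/eqP -> := eM (r x).
  - case/morphimP=> g _ Gg ->; rewrite !FE ?XJ // rJ // -fJ //.
    by have /forall_inP/(_ g Gg)/eqP -> := eJ (r x).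
  - by rewrite ffunE nXx.
pose F (h : {ffun coset_of Y -> coset_of Y}) : {ffun A -> A} :=
  [ffun a => r (h (f a))].
have injF : {in equi_endos (G / Y) (X / Y) &, injective F}.
  move=> h h' /equi_endosP[h1 _ _ h4] /equi_endosP[k1 _ _ k4] /ffunP eqF.
  apply/ffunP=> x; have [Xx | nXx] := boolP (x \in X / Y);
    last by rewrite h4 ?k4.
  have := eqF (r x); rewrite !ffunE rK // => /(congr1 f).
  by rewrite !rK ?h1 ?k1.
rewrite -(card_in_imset injF); apply/subset_leq_card/subsetP=> e /imsetP[h].
case/equi_endosP=> h1 h2 h3 _ ->; rewrite inE; apply/andP; split.
  apply/forallP=> a; apply/forallP=> b; rewrite !ffunE fM h2 // rM ?h1 //.
apply/forallP=> a; apply/forall_inP=> g Gg.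
by rewrite !ffunE fJ // h3 ?mem_quotient // rJ ?h1.
Qed.

End EndModule.

(** * Noncentral chief factors *)

Section ChiefFactors.

Variable gT : finGroupType.
Implicit Types (G D M N X Y : {group gT}).

Lemma End_gt2_factor G M (N : {group coset_of M}) :
    solvable G -> End_gt2_property G -> M <| G ->
    minnormal_in N (G / M) -> [splits G / M, over N] ->
    ~~ (G / M \subset 'C(N)) ->
  2 < #|equi_endos (G / M) N|.
Proof.
move=> solG gtE nsMG minN splN ncN.
have [mN sNG ntN nsNG] := minnormal_inW minN; have nNG := normal_norm nsNG.
have abN := minnormal_abelian (quotient_sol M solG) minN.
have [X defN sMX nsXG] := inv_quotientN nsMG nsNG.
have isoX : module_isog_factor X M (factor_module nsMG nNG).
  exists (sgval_morphism N); first by rewrite -defN; apply: isom_sgval.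
  by move=> a g Gg; apply: factor_moduleE.
have nXG : G / M \subset 'N(X / M) by rewrite -defN.
have -> : #|equi_endos (G / M) N| = #|equi_endos (G / M) (X / M)|.
  by congr #|_|; congr equi_endos; apply: val_inj.
rewrite -(card_End_module nXG isoX); apply: gtE.
  exact: factor_module_irr.
exists X, M; split=> //; split; last by rewrite -defN.
rewrite /chief_factor nsXG andbT.
apply: minnormal_maxnormal; rewrite ?normal_norm
  ?(normalS _ (normal_sub nsXG)) //.
by rewrite -defN.
Qed.

(** Either N :&: D is trivial and [N, D] = 1, or N is contained in D, where it
meets the centre of D, and is therefore central in D. *)
Lemma nilpotent_cent_minnormal G N D :
  minnormal_in N G -> D <| G -> nilpotent D -> D \subset 'C(N).
Proof.
move=> minN nsDG nilD; have [mN sNG ntN nsNG] := minnormal_inW minN.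
have [[sDG nDG] nNG] := (andP nsDG, normal_norm nsNG).
have [_ minN'] := mingroupP mN.
have [ND0 | ntND] := eqVneq (N :&: D) 1.
  rewrite centsC; apply/commG1P/trivgP; rewrite -ND0.
  by rewrite commg_subI // subsetI subxx ?(subset_trans sNG)
    ?(subset_trans sDG).
have defI : N :&: D = N.
  by apply: minN' (subsetIl _ _); rewrite ntND normsI.
have nsND : N <| D by rewrite /normal -defI subsetIr (subset_trans sDG) ?normsI.
have ntZ := meet_center_nil nilD nsND ntN.
have <- : N :&: 'Z(D) = N.
  apply: minN' (subsetIl _ _); rewrite ntZ normsI //.
  exact: gFnorm_trans.
by rewrite centsC (subset_trans (subsetIr _ _)) // subsetIr.
Qed.

End ChiefFactors.

Section DerivedSubgroup.

Variable gT : finGroupType.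
Implicit Types (G D M N X Y : {group gT}).

(** Conjugations by elements of G commute on N, so each of them is an
endomorphism. *)
Lemma endo_gt2_der_cent G N :
    minnormal_in N G -> abelian N -> G^`(1) \subset 'C(N) ->
      ~~ (G \subset 'C(N)) ->
  2 < #|equi_endos G N|.
Proof.
move=> minN abN cDN ncN; have [_ sNG ntN nsNG] := minnormal_inW minN.
have nNG := normal_norm nsNG.
have [g Gg ncg] := subsetPn ncN; rewrite ltnNge; apply: contra ncg => leE.
have NJ x h : x \in N -> h \in G -> x ^ h \in N.
  by move=> Nx Gh; rewrite memJ_norm // (subsetP nNG).
pose f := [ffun x => if x \in N then x ^ g else 1].
have Ef : f \in equi_endos G N.
  apply/equi_endosP; split=> [x Nx|x y Nx Ny|x h Nx Gh|x /negbTE nNx].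
  - by rewrite ffunE Nx NJ.
  - by rewrite !ffunE Nx Ny groupM // conjMg.
  - rewrite !ffunE Nx NJ // -!conjgM (commgC h g) [LHS]conjgM.
    apply/conjg_fixP/commgP; apply: commute_sym; apply: (centsP cDN).
      by rewrite derg1 mem_commg.
    by rewrite NJ ?groupM.
  - by rewrite ffunE nNx.
apply/centP=> x Nx; apply: commute_sym; apply/commgP/conjg_fixP.
have [f0 | f1] := endo_01 nNG abN ntN leE Ef.
  have [z Nz /negP[]] := trivgPn _ ntN.
  by have := f0 z Nz; rewrite ffunE Nz => /eqP; rewrite conjg_eq1.
by have := f1 x Nx; rewrite ffunE Nx.
Qed.

(** With at most two endomorphisms N is a 2-group, but N = [N, G] lies in the
derived subgroup. *)
Lemma endo_gt2_der_odd G N :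
    solvable G -> minnormal_in N G -> odd #|G^`(1)| -> ~~ (G \subset 'C(N)) ->
  2 < #|equi_endos G N|.
Proof.
move=> solG minN oddD ncN; have [mN sNG ntN nsNG] := minnormal_inW minN.
have nNG := normal_norm nsNG; have [_ minN'] := mingroupP mN.
rewrite ltnNge; apply: contra ntN => /(endo_le2_abelem2 solG minN) abN2.
have sND : N \subset G^`(1).
  rewrite derg1 (subset_trans _ (commSg _ sNG)) //.
  have -> // : [~: N, G] = N.
  apply: (minN' [~: N, G]%G); last by rewrite commg_subl.
  by rewrite normsR ?normG // andbT; apply: contra ncN => /eqP/commG1P;
    rewrite centsC.
have oddN := dvdn_odd (cardSg sND) oddD.
have [m cardN] := p_natP (abelem_pgroup abN2).
rewrite cardN oddX orbF in oddN.
by rewrite trivg_card1 cardN (eqP oddN).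
Qed.

End DerivedSubgroup.

Lemma End_gt2_of_derived (gT : finGroupType) (G : {group gT}) : solvable G ->
  nilpotent G^`(1) \/ odd #|G^`(1)| -> End_gt2_property G.
Proof.
move=> solG derG A to [_ _ ncA] [X [Y [[chiefXY _] isoA]]].
have /andP[maxY /andP[sXG nXG]] := chiefXY.
have nYG : G \subset 'N(Y) by case/andP: (maxgroupp maxY).
have minN : minnormal_in (X / Y)%G (G / Y)%G.
  by rewrite /minnormal_in chief_factor_minnormal // quotientS.
have solGY := quotient_sol Y solG.
have ncN : ~~ (G / Y \subset 'C(X / Y)).
  apply: contra ncA => cN; have [f /isomP[injf imf] fJ] := isoA.
  apply/subsetP=> g Gg; rewrite inE Gg inE; apply/subsetP=> a _.
  rewrite inE; apply/eqP; apply: (injmP injf); rewrite ?inE // fJ //.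
  apply/conjg_fixP/commgP; apply: commute_sym; apply: (centsP cN).
    exact: mem_quotient.
  by rewrite -imf mem_morphim ?inE.
rewrite (card_End_module (quotient_norms Y nXG) isoA).
case: derG => [nilD | oddD].
  apply: (endo_gt2_der_cent minN (minnormal_abelian solGY minN) _ ncN).
  apply: (@nilpotent_cent_minnormal _ (G / Y) (X / Y) (G / Y)^`(1)) => //.
    exact: der_normal.
  by rewrite /= -(quotient_der 1 nYG) quotient_nil.
apply: (endo_gt2_der_odd solGY minN _ ncN).
by rewrite /= -(quotient_der 1 nYG) (dvdn_odd (dvdn_quotient _ _)).
Qed.

(** * The graph *)

Section Graph.

Variables (gT : finGroupType) (G : {group gT}).
Implicit Types x y z : seq gT.

Lemma gen_cat t x (y : {ffun 'I_t -> gT}) :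
  <<[set:: x ++ codom y]>> = <<[set:: x]>> <*> entries y.
Proof.
rewrite joing_idl; congr <<_>>; apply/setP=> g; rewrite !inE mem_cat.
congr (_ || _); apply/codomP/imsetP=> [[i ->] | [i _ ->]]; by exists i.
Qed.

Lemma in_pow_sub k x : in_pow G k x -> <<[set:: x]>> \subset G.
Proof.
case/andP=> _ /allP xG; rewrite gen_subG; apply/subsetP=> g; rewrite inE.
exact: xG.
Qed.

Lemma in_pow_codom t (y : {ffun 'I_t -> gT}) : in_pow G t (codom y) =
  (y \in cpow t G).
Proof.
rewrite /in_pow size_codom card_ord eqxx /=;
  apply/allP/cpowP=> [yG i | yG _ /codomP[i ->]].
  exact/yG/codom_f.
exact: yG.
Qed.

Lemma in_pow_codomP t z : in_pow G t z ->
  exists2 y : {ffun 'I_t -> gT}, y \in cpow t G & z = codom y.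
Proof.
move=> Gz; have /andP[/eqP sz _] := Gz; pose y := [ffun i : 'I_t => nth 1 z i].
have def_z : z = codom y.
  apply: (@eq_from_nth _ 1); first by rewrite size_codom card_ord.
  rewrite sz => i lt_i; rewrite -[i]/(val (Ordinal lt_i)).
  by rewrite codomE (nth_map (Ordinal lt_i)) ?size_enum_ord // ffunE
    nth_ord_enum.
by exists y => //; rewrite -in_pow_codom -def_z.
Qed.

Lemma Gamma_adjC a b x y : Gamma_adj G a b x y = Gamma_adj G a b y x.
Proof.
rewrite /Gamma_adj orbC; congr (_ && _).
  by rewrite andbC [X in _ || X]andbC.
congr (_ == _); congr <<_>>; apply/setP=> g.
by rewrite !inE !mem_cat orbC.
Qed.

Lemma Gamma_partP a b s t x : (s = a /\ t = b) \/ (s = b /\ t = a) ->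
    Gamma_star_part G a b s x ->
  exists y : {ffun 'I_t -> gT},
    y \in cpow t G /\ <<[set:: x]>> <*> entries y = G.
Proof.
move=> st [[_ nisol] Gx].
have [/existsP[y /andP[Gy /eqP gen]] | nex] :=
  boolP [exists y : {ffun 'I_t -> gT},
           (y \in cpow t G) && (<<[set:: x]>> <*> entries y == G)].
  by exists y.
case: nisol => z _; apply: contra nex => /andP[Gxz /eqP gen].
have Gz : in_pow G t z.
  have /andP[/eqP sx _] := Gx.
  case/orP: Gxz => /andP[/andP[/eqP sxa _] Gz]; case: st => [[sa tb] | [sb ta]];
    subst; rewrite ?tb ?ta //; congruence.
have [y Gy defz] := in_pow_codomP Gz.
by apply/existsP; exists y; rewrite Gy -gen_cat -defz gen eqxx.
Qed.

End Graph.

Theorem theorem3p10 (gT : finGroupType) (G : {group gT}) (solG : solvable G) :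
  (forall a b s t : nat,
     s = a \/ s = b ->
     t = (a + b - s)%N ->
     t <> 1%N \/ End_gt2_property G ->
     forall x1 x2 : seq gT,
       Gamma_star_part G a b s x1 -> Gamma_star_part G a b s x2 ->
       exists y : seq gT,
         [/\ Gamma_star_part G a b t y,
             Gamma_star_adj G a b y x1 & Gamma_star_adj G a b y x2])
  /\ (nilpotent G^`(1) \/ odd #|G^`(1)| -> End_gt2_property G).
Proof.
split; last exact: End_gt2_of_derived.
move=> a b s t sab tE gtE x1 x2 V1 V2.
have st : (s = a /\ t = b) \/ (s = b /\ t = a).
  by case: sab => ?; subst; [left; rewrite addKn | right; rewrite addnK].
have [[v1 _] G1] := V1; have [[v2 _] G2] := V2.
have [y1 [Gy1 gen1]] := Gamma_partP st V1.
have [y2 [Gy2 gen2]] := Gamma_partP st V2.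
have [|y [Gy def1 def2]] := common_completion solG (in_pow_sub G1)
  (in_pow_sub G2)
  Gy1 gen1 Gy2 gen2.
  by case: gtE => // gtE _ M N; apply: End_gt2_factor.
have Gc : in_pow G t (codom y) by rewrite in_pow_codom.
have vy : Gamma_vertex G a b (codom y).
  by rewrite /Gamma_vertex; case: st => -[_ <-]; rewrite Gc ?orbT.
have adj x : in_pow G s x -> <<[set:: x]>> <*> entries y = G ->
  Gamma_adj G a b x (codom y).
  move=> Gx gen; rewrite /Gamma_adj gen_cat gen eqxx andbT.
  by case: st => -[<- <-]; rewrite Gx Gc ?orbT.
have adj1 := adj _ G1 def1; have adj2 := adj _ G2 def2.
have star_y : Gamma_star_vertex G a b (codom y).
  by split=> // /(_ x1 v1); rewrite Gamma_adjC adj1.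
exists (codom y); split=> //.
- by split=> //; [case: V1 | rewrite Gamma_adjC].
- by split=> //; [case: V2 | rewrite Gamma_adjC].
Qed.
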